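(* Consider a two-user Gaussian broadcast (BC) network with average power constraint $E[P(t)]\le\tilde P$, and its dual multiple access (MAC) networks, i.e. MAC networks with per-user average power constraints $E[P_1(t)]\le\tilde P_1$, $E[P_2(t)]\le\tilde P_2$ with $\tilde P_1+\tilde P_2=\tilde P$ (all networks as described in the context, with the same channel statistics, unit noise variance, and the same finite set of codebook rates at every MAC user and at the BC transmitter). Then the stability region of the BC network is equal to the union, over all $(\tilde P_1,\tilde P_2)$ with $\tilde P_1,\tilde P_2\ge0$ and $\tilde P_1+\tilde P_2=\tilde P$, of the stability regions of the dual MAC networks.
   Context: Setting: time is slotted; in each slot each transmitter sends at most one fixed-length Gaussian codeword, with rate chosen from a common finite set $\mathcal{R}=\{0,R_0,\dots,R_{M-1}\}$ (rate $0$ = no transmission); the same set is used by both MAC users and for each user's codeword at the BC transmitter. The fading gain vector $\vec h(t)=(h_1(t),h_2(t))$ (Rayleigh fading) is stationary ergodic, constant during a slot, known to a centralized scheduler (which may choose rates and powers as functions of the channel state), and has identical statistics in the BC and MAC networks; all receivers have additive white Gaussian noise of unit variance; logs are base 2. Decoding is successive decoding with interference cancellation of whole codewords (no rate splitting). MAC (two transmitters, one receiver): under decoding order ''user $j$ first, then $k$'', rates $(r_1,r_2)$ are transmittable with powers $(P_1,P_2)$ iff $\log(1+h_j^2P_j/(1+h_k^2P_k))\ge r_j$ and $\log(1+h_k^2P_k)\ge r_k$; either order may be chosen each slot. BC (one transmitter, two receivers, power split $P_1+P_2=P(t)$): if $h_1\ge h_2$, $(r_1,r_2)$ is transmittable iff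 $\log(1+h_1^2P_1)\ge r_1$ and $\log(1+h_2^2P_2/(1+h_2^2P_1))\ge r_2$, symmetrically if $h_2>h_1$. Stability region: the closure of the set of arrival rate vectors for which the user queues can be kept stable (a queue process $Q(t)$ is stable if $\lim_{x\to\infty}\limsup_{t\to\infty}\Pr[Q(t)>x]=0$) by some centralized scheduling and power allocation policy with full knowledge of arrival statistics, queue and channel states; equivalently, the set of long-run average departure rate vectors achievable when all queues are infinitely backlogged. *)

(* Defs.v *)
From HB Require Import structures.
From mathcomp Require Import all_boot all_order all_algebra.
From mathcomp Require Import all_classical all_reals all_analysis.

Set Implicit Arguments.
Unset Strict Implicit.
Unset Printing Implicit Defensive.

Import Order.TTheory GRing.Theory Num.Theory.
Import numFieldNormedType.Exports.

Local Open Scope classical_set_scope.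
Local Open Scope ring_scope.

Section Defs.
Context {R : realType}.

Definition log2 (x : R) : R := ln x / ln 2.

Definition rate_ok (Rs : seq R) (r : R) : Prop := r = 0 \/ r \in Rs.

(** MAC: gain vector h, rates r, powers p; decoding order chosen freely *)
Definition MAC_transmittable (h r p : R * R) : Prop :=
  0 <= p.1 /\ 0 <= p.2 /\
  ( (* user 1 decoded first, then user 2 *)
    (r.1 <= log2 (1 + h.1 ^+ 2 * p.1 / (1 + h.2 ^+ 2 * p.2)) /\
     r.2 <= log2 (1 + h.2 ^+ 2 * p.2))
  \/ (* user 2 decoded first, then user 1 *)
    (r.2 <= log2 (1 + h.2 ^+ 2 * p.2 / (1 + h.1 ^+ 2 * p.1)) /\
     r.1 <= log2 (1 + h.1 ^+ 2 * p.1))).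

(** BC: power split p.1 + p.2 = P(t) *)
Definition BC_transmittable (h r p : R * R) : Prop :=
  0 <= p.1 /\ 0 <= p.2 /\
  (if h.2 <= h.1 then
     r.1 <= log2 (1 + h.1 ^+ 2 * p.1) /\
     r.2 <= log2 (1 + h.2 ^+ 2 * p.2 / (1 + h.2 ^+ 2 * p.1))
   else
     r.2 <= log2 (1 + h.2 ^+ 2 * p.2) /\
     r.1 <= log2 (1 + h.1 ^+ 2 * p.1 / (1 + h.1 ^+ 2 * p.2))).

Context {d : measure_display} {Omega : measurableType d}.

(** Channel model: the fading process is h(t) = H (T^t w), with T a measure-preserving
    ergodic transformation (so (h(t)) is stationary ergodic), and each gain h_i(t)
    Rayleigh distributed with scale s_i. *)
Definition channel_model (P : probability Omega R) (T : Omega -> Omega)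
    (H : Omega -> R * R) (s1 s2 : R) : Prop :=
  measurable_fun [set: Omega] T /\
  [/\ (forall A, measurable A -> P (T @^-1` A) = P A),
      (forall A, measurable A -> T @^-1` A = A -> P A = 0%E \/ P A = 1%E),
      (measurable_fun [set: Omega] (fun w => (H w).1) /\
       measurable_fun [set: Omega] (fun w => (H w).2)),
      (0 < s1 /\ 0 < s2) &
      (forall x, 0 <= x ->
         P [set w | (H w).1 <= x] = (1 - expR (- x ^+ 2 / (2 * s1 ^+ 2)))%:E /\
         P [set w | (H w).2 <= x] = (1 - expR (- x ^+ 2 / (2 * s2 ^+ 2)))%:E)].

Definition traj (T : Omega -> Omega) (H : Omega -> R * R) (w : Omega) : nat -> R * R :=
  fun t => H (iter t T w).

(** A scheduling/power-allocation policy: at slot t, given the channel history,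
    choose (rates, powers) = ((r1, r2), (P1, P2)). *)
Definition policy := nat -> (nat -> R * R) -> (R * R) * (R * R).

Definition causal (pi : policy) : Prop :=
  forall t g g', (forall s, (s <= t)%N -> g s = g' s) -> pi t g = pi t g'.

(** Arrival-rate vectors supported with infinitely backlogged queues: long-run average
    departure rates (almost surely) at least lam, under an admissible policy. *)
Definition supported (P : probability Omega R) (T : Omega -> Omega) (H : Omega -> R * R)
    (Rs : seq R) (trans : R * R -> R * R -> R * R -> Prop)
    (powc : policy -> Prop) : set (R * R) :=
  [set lam | 0 <= lam.1 /\ 0 <= lam.2 /\
    exists pi : policy,
      [/\ causal pi,
          (forall t, measurable_fun [set: Omega] (fun w => (pi t (traj T H w)).2.1) /\
                     measurable_fun [set: Omega] (fun w => (pi t (traj T H w)).2.2)),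
          powc pi,
          (forall t w, rate_ok Rs (pi t (traj T H w)).1.1 /\
                       rate_ok Rs (pi t (traj T H w)).1.2 /\
                       trans (traj T H w t) (pi t (traj T H w)).1 (pi t (traj T H w)).2) &
          {ae P, forall w, forall e : R, 0 < e -> exists N : nat, forall n : nat, (N <= n)%N ->
              lam.1 - e <= n%:R^-1 * \sum_(t < n) (pi t (traj T H w)).1.1 /\
              lam.2 - e <= n%:R^-1 * \sum_(t < n) (pi t (traj T H w)).1.2}]].

Definition BC_stability_region (P : probability Omega R) T H (Rs : seq R) (Pt : R)
  : set (R * R) :=
  closure (supported P T H Rs BC_transmittable
    (fun pi => forall t, (\int[P]_w ((pi t (traj T H w)).2.1
                                    + (pi t (traj T H w)).2.2)%:E <= Pt%:E)%E)).

Definition MAC_stability_region (P : probability Omega R) T H (Rs : seq R) (P1 P2 : R)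
  : set (R * R) :=
  closure (supported P T H Rs MAC_transmittable
    (fun pi => forall t,
       (\int[P]_w ((pi t (traj T H w)).2.1)%:E <= P1%:E)%E /\
       (\int[P]_w ((pi t (traj T H w)).2.2)%:E <= P2%:E)%E)).

End Defs.

(* Main.v *)
(* For given gains and rates, the least total transmit power is the same in the
   BC and in the MAC (decoding the stronger MAC user first), but the MAC powers
   split it between the users.  Both regions therefore coincide with the set of
   rate vectors reachable by stationary rate maps [h |-> rates] whose mean minimal
   power is at most [Pt].

   From an arbitrary policy one gets a stationary one as follows: on finitely many
   cells of nearly constant cost, record how often each rate pair is used, and
   realize these frequencies by splitting every cell along the (continuously
   distributed) first gain.  Conversely a stationary map attains its mean rates by
   a one-sided Birkhoff theorem for bounded functions.  The power split of the MAC
   is a cluster point of the splits of better and better stationary maps; using the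
   maps on a slightly smaller set of gains makes the power constraint exact, except
   for a user whose limit power is 0, who has rate 0 and can be silenced. *)
Require Import Defs.
From HB Require Import structures.
From mathcomp Require Import all_boot all_order all_algebra.
From mathcomp Require Import all_classical all_reals all_analysis.
From mathcomp Require Import measurable_realfun ring lra.
Import Order.TTheory GRing.Theory Num.Theory.
Import numFieldNormedType.Exports.
Local Open Scope classical_set_scope.
Local Open Scope ring_scope.

(** * Minimal powers and duality *)

(** Policies are deterministic functions of the gains, and the power constraint binds in every
    single slot. Frequencies can therefore be realized neither by coin tosses nor by alternating
    between slots; the continuous law of the first gain supplies the missing randomness. Duality
    holds state by state only for the sum of the powers, whereas the MAC budgets bind user by user.
    Different accuracies may produce different splits, so a limit of splits has to be taken, and the
    error it leaves in the powers must be paid for in rate. Thinning a map by a factor [theta]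
    scales powers and rates together and so absorbs any small relative excess of power. An excess
    over a budget 0 is never relatively small, which is why that case is separate. Since the regions
    are closures, every demand may be lowered slightly. Mean rates strictly above the demand are
    then enough, and averages along orbits only have to be bounded from below. *)

Section Duality.
Context {R : realType}.
Implicit Types (r x : R) (h p : R * R).

(** This is 2^r - 1, the signal-to-noise ratio from which a Gaussian codeword of rate [r] is
    decodable. *)
Definition snr_gap (r : R) : R := expR (r * ln 2) - 1.

Lemma ln2_gt0 : 0 < ln 2 :> R.
Proof. by rewrite ln_gt0// ltr1n. Qed.

Lemma snr_gap0 : snr_gap 0 = 0.
Proof. by rewrite /snr_gap mul0r expR0 subrr. Qed.

Lemma snr_gap_ge0 {r} : 0 <= r -> 0 <= snr_gap r.
Proof.
move=> r0; rewrite subr_ge0 -[leLHS]expR0 ler_expR.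
by rewrite mulr_ge0// ltW// ln2_gt0.
Qed.

Lemma le_log2 r x : 0 <= x -> (r <= log2 (1 + x)) = (snr_gap r <= x).
Proof.
move=> x0; have x1 : 0 < 1 + x by lra.
rewrite /log2 ler_pdivlMr ?ln2_gt0// -[LHS]ler_expR (@lnK R (1 + x)) ?posrE//.
by rewrite /snr_gap lerBlDl.
Qed.

(* The componentwise smallest powers for the decoding order that minimizes the
   total power: the stronger user is decoded first, so the weaker one sees no
   interference. *)
Definition mac_power1 (h r : R * R) : R :=
  snr_gap r.1 * (if h.2 <= h.1 then 1 + snr_gap r.2 else 1) / h.1 ^+ 2.

Definition mac_power2 (h r : R * R) : R :=
  snr_gap r.2 * (if h.2 <= h.1 then 1 else 1 + snr_gap r.1) / h.2 ^+ 2.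

(** The smallest BC powers. Interference now burdens the weaker user, while in [mac_power1] and
    [mac_power2] it burdens the stronger one. *)
Definition bc_power (h r : R * R) : R * R :=
  (snr_gap r.1 * (if h.2 <= h.1 then 1 else 1 + h.1 ^+ 2 * (snr_gap r.2 / h.2 ^+ 2))
     / h.1 ^+ 2,
   snr_gap r.2 * (if h.2 <= h.1 then 1 + h.2 ^+ 2 * (snr_gap r.1 / h.1 ^+ 2) else 1)
     / h.2 ^+ 2).

Section fixed_gains.
Variables (h r : R * R).
Hypotheses (h1 : 0 < h.1) (h2 : 0 < h.2) (r1 : 0 <= r.1) (r2 : 0 <= r.2).

Let a1 := snr_gap r.1.
Let a2 := snr_gap r.2.
Let a1_ge0 : 0 <= a1. Proof. exact: snr_gap_ge0. Qed.
Let a2_ge0 : 0 <= a2. Proof. exact: snr_gap_ge0. Qed.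
Let H1 : 0 < h.1 ^+ 2. Proof. exact: exprn_gt0. Qed.
Let H2 : 0 < h.2 ^+ 2. Proof. exact: exprn_gt0. Qed.

(** With a_j the [snr_gap] of rate j, both totals are a1/h1^2 + a2/h2^2 + a1 a2/max(h1,h2)^2; the
    networks only charge the last term to different users. *)
Lemma bc_power_sum :
  (bc_power h r).1 + (bc_power h r).2 = mac_power1 h r + mac_power2 h r.
Proof.
rewrite /bc_power /mac_power1 /mac_power2.
by case: ifP => _ /=; field; rewrite !lt0r_neq0.
Qed.

Lemma mac_power1_ge0 : 0 <= mac_power1 h r.
Proof.
rewrite /mac_power1 -/a1 -/a2; apply: divr_ge0 (ltW H1); apply: mulr_ge0 => //.
by have := a2_ge0; case: ifP => _; lra.
Qed.

Lemma mac_power2_ge0 : 0 <= mac_power2 h r.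
Proof.
rewrite /mac_power2 -/a1 -/a2; apply: divr_ge0 (ltW H2); apply: mulr_ge0 => //.
by have := a1_ge0; case: ifP => _; lra.
Qed.

Lemma bc_power1_ge0 : 0 <= (bc_power h r).1.
Proof.
apply: divr_ge0 (ltW H1); apply: mulr_ge0 => //; case: ifP => // _.
by apply: addr_ge0 => //; apply: mulr_ge0 (divr_ge0 _ _) => //; exact: ltW.
Qed.

Lemma bc_power2_ge0 : 0 <= (bc_power h r).2.
Proof.
apply: divr_ge0 (ltW H2); apply: mulr_ge0 => //; case: ifP => // _.
by apply: addr_ge0 => //; apply: mulr_ge0 (divr_ge0 _ _) => //; exact: ltW.
Qed.

Let snr_noint (a H x : R) : 0 < H -> x = a / H -> a <= H * x.
Proof. by move=> H0 ->; rewrite mulrC divfK// gt_eqF. Qed.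

Let snr_int (a H x y : R) : 0 < H -> 0 < y -> x = a * y / H -> a <= H * x / y.
Proof. by move=> H0 y0 ->; rewrite ler_pdivlMr// [leRHS]mulrC divfK// gt_eqF. Qed.

Lemma MAC_transmittable_mac_power :
  MAC_transmittable h r (mac_power1 h r, mac_power2 h r).
Proof.
split; first exact: mac_power1_ge0.
split; first exact: mac_power2_ge0.
have m1 := mac_power1_ge0; have m2 := mac_power2_ge0.
have g1 : 0 <= h.1 ^+ 2 * mac_power1 h r by rewrite mulr_ge0// ltW.
have g2 : 0 <= h.2 ^+ 2 * mac_power2 h r by rewrite mulr_ge0// ltW.
have [hh|hh] := boolP (h.2 <= h.1); [left|right] => /=.
- rewrite !le_log2//; last by rewrite divr_ge0// addr_ge0.
  have e2 : mac_power2 h r = a2 / h.2 ^+ 2.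
    by rewrite /mac_power2 hh mulr1.
  split; last exact: snr_noint.
  apply: snr_int => //; first by rewrite ltr_wpDr.
  by rewrite e2 /mac_power1 hh -/a1 -/a2; field; rewrite !gt_eqF.
- rewrite !le_log2//; last by rewrite divr_ge0// addr_ge0.
  have e1 : mac_power1 h r = a1 / h.1 ^+ 2.
    by rewrite /mac_power1 (negbTE hh) mulr1.
  split; last exact: snr_noint.
  apply: snr_int => //; first by rewrite ltr_wpDr.
  by rewrite e1 /mac_power2 (negbTE hh) -/a1 -/a2; field; rewrite !gt_eqF.
Qed.

Lemma BC_transmittable_bc_power : BC_transmittable h r (bc_power h r).
Proof.
split; first exact: bc_power1_ge0.
split; first exact: bc_power2_ge0.
have := bc_power1_ge0; have := bc_power2_ge0.
rewrite /bc_power /= -/a1 -/a2.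
case: ifP => hh; rewrite mulr1 => p2 p1.
- have g1 : 0 <= h.1 ^+ 2 * (a1 / h.1 ^+ 2) by rewrite mulr_ge0// ltW.
  have g2 : 0 <= h.2 ^+ 2 * (a1 / h.1 ^+ 2) by rewrite mulr_ge0// ltW.
  rewrite !le_log2//; last by rewrite divr_ge0 ?addr_ge0// mulr_ge0// ltW.
  split; first exact: snr_noint.
  by apply: snr_int; rewrite // ltr_wpDr.
- have g1 : 0 <= h.1 ^+ 2 * (a2 / h.2 ^+ 2) by rewrite mulr_ge0// ltW.
  have g2 : 0 <= h.2 ^+ 2 * (a2 / h.2 ^+ 2) by rewrite mulr_ge0// ltW.
  rewrite !le_log2//; last by rewrite divr_ge0 ?addr_ge0// mulr_ge0// ltW.
  split; first exact: snr_noint.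
  by apply: snr_int; rewrite // ltr_wpDr.
Qed.

Let power_noint (a H x : R) : 0 < H -> (a <= H * x) = (a * H^-1 <= x).
Proof. by move=> H0; rewrite mulrC ler_pdivrMr// mulrC (mulrC H). Qed.

Let power_int (a H x y : R) : 0 < H -> 0 < y ->
  (a <= H * x / y) = (a * y * H^-1 <= x).
Proof. by move=> H0 y0; rewrite ler_pdivlMr// ler_pdivrMr// (mulrC H). Qed.

Lemma BC_transmittable_power p : BC_transmittable h r p ->
  mac_power1 h r + mac_power2 h r <= p.1 + p.2.
Proof.
move=> [p1 [p2]].
have i1 : 0 < (h.1 ^+ 2)^-1 by rewrite invr_gt0.
have i2 : 0 < (h.2 ^+ 2)^-1 by rewrite invr_gt0.
have ? := a1_ge0; have ? := a2_ge0.
have HH1 := H1; have HH2 := H2.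
have q11 : 0 <= h.1 ^+ 2 * p.1 by rewrite mulr_ge0// ltW.
have q22 : 0 <= h.2 ^+ 2 * p.2 by rewrite mulr_ge0// ltW.
have q21 : 0 <= h.2 ^+ 2 * p.1 by rewrite mulr_ge0// ltW.
have q12 : 0 <= h.1 ^+ 2 * p.2 by rewrite mulr_ge0// ltW.
rewrite /mac_power1 /mac_power2 -/a1 -/a2.
case: ifP => hh; rewrite !le_log2 ?divr_ge0 ?addr_ge0//.
- rewrite power_noint// power_int ?ltr_wpDr// -/a1 -/a2 => -[k1 k2].
  (* The power of the weaker user contains [a2 * p.1]; inserting the lower bound on [p.1] produces
     the product term of the minimal sum. *)
  have := ler_wpM2l a2_ge0 k1.
  have -> : a2 * p.1 = a2 * (h.2 ^+ 2 * p.1) * (h.2 ^+ 2)^-1.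
    by field; rewrite gt_eqF.
  by move: k1 k2; lra.
- rewrite power_noint// power_int ?ltr_wpDr// -/a1 -/a2 => -[k2 k1].
  have := ler_wpM2l a1_ge0 k2.
  have -> : a1 * p.2 = a1 * (h.1 ^+ 2 * p.2) * (h.1 ^+ 2)^-1.
    by field; rewrite gt_eqF.
  by move: k1 k2; lra.
Qed.

(** Either decoding order costs at least the two interference-free powers plus a1 a2 over the
    squared gain of the user decoded first. Decoding the stronger user first minimizes this last
    term. *)
Lemma MAC_transmittable_power p : MAC_transmittable h r p ->
  mac_power1 h r + mac_power2 h r <= p.1 + p.2.
Proof.
move=> [p1 [p2]].
have i1 : 0 < (h.1 ^+ 2)^-1 by rewrite invr_gt0.
have i2 : 0 < (h.2 ^+ 2)^-1 by rewrite invr_gt0.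
have A1 := a1_ge0; have A2 := a2_ge0.
have q11 : 0 <= h.1 ^+ 2 * p.1 by rewrite mulr_ge0// ltW.
have q22 : 0 <= h.2 ^+ 2 * p.2 by rewrite mulr_ge0// ltW.
have AA : 0 <= a1 * a2 by rewrite mulr_ge0.
have best : mac_power1 h r + mac_power2 h r =
    a1 * (h.1 ^+ 2)^-1 + a2 * (h.2 ^+ 2)^-1 +
    a1 * a2 * (if h.2 <= h.1 then (h.1 ^+ 2)^-1 else (h.2 ^+ 2)^-1).
  by rewrite /mac_power1 /mac_power2 -/a1 -/a2; case: ifP => _; ring.
have le1 : a1 * a2 * (if h.2 <= h.1 then (h.1 ^+ 2)^-1 else (h.2 ^+ 2)^-1)
    <= a1 * a2 * (h.1 ^+ 2)^-1.
  rewrite ler_wpM2l//; case: (leP h.2 h.1) => // hh.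
  by rewrite lef_pV2 ?posrE// ler_pXn2r ?nnegrE// ltW.
have le2 : a1 * a2 * (if h.2 <= h.1 then (h.1 ^+ 2)^-1 else (h.2 ^+ 2)^-1)
    <= a1 * a2 * (h.2 ^+ 2)^-1.
  rewrite ler_wpM2l//; case: (leP h.2 h.1) => // hh.
  by rewrite lef_pV2 ?posrE// ler_pXn2r ?nnegrE// ltW.
rewrite best; case; rewrite !le_log2 ?divr_ge0 ?addr_ge0//.
- rewrite (power_noint _ _ p.2)// power_int ?ltr_wpDr// -/a1 -/a2 => -[k1 k2].
  have k2' : a2 <= h.2 ^+ 2 * p.2 by rewrite power_noint.
  have k : a1 * (1 + a2) * (h.1 ^+ 2)^-1 <= p.1.
    apply: le_trans k1; apply: (ler_wpM2r (ltW i1)); apply: (ler_wpM2l A1); lra.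
  by move: k k2 le1; lra.
- rewrite (power_noint _ _ p.1)// power_int ?ltr_wpDr// -/a1 -/a2 => -[k1 k2].
  have k2' : a1 <= h.1 ^+ 2 * p.1 by rewrite power_noint.
  have k : a2 * (1 + a1) * (h.2 ^+ 2)^-1 <= p.2.
    apply: le_trans k1; apply: (ler_wpM2r (ltW i2)); apply: (ler_wpM2l A2); lra.
  by move: k k2 le2; lra.
Qed.

End fixed_gains.
End Duality.

(** * Probability *)

Section Probability.
Context {R : realType} {d : measure_display} {Omega : measurableType d}.
Variable P : probability Omega R.
Implicit Types (A B : set Omega) (f g : Omega -> R).

Definition prob A : R := fine (P A).

Lemma probE A : measurable A -> P A = (prob A)%:E.
Proof. by move=> mA; rewrite fineK// fin_num_measure. Qed.

Lemma prob_ge0 A : 0 <= prob A.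
Proof. exact: fine_ge0. Qed.

Lemma prob_le A B : measurable A -> measurable B -> A `<=` B ->
  prob A <= prob B.
Proof.
by move=> mA mB AB; rewrite fine_le ?fin_num_measure// le_measure ?inE.
Qed.

Lemma prob_setT : prob setT = 1.
Proof. by rewrite /prob probability_setT. Qed.

Lemma probU A B : measurable A -> measurable B -> A `&` B = set0 ->
  prob (A `|` B) = prob A + prob B.
Proof.
move=> mA mB AB0; apply: EFin_inj; rewrite EFinD -!probE//.
  by rewrite measureU.
exact: measurableU.
Qed.

Lemma prob_setC A : measurable A -> prob (~` A) = 1 - prob A.
Proof.
move=> mA; apply/eqP; rewrite eq_sym subr_eq -probU ?setICl//.
- by rewrite setvU prob_setT.
- exact: measurableC.
Qed.

Lemma integral_probability_cst (c : R) : (\int[P]_w c%:E = c%:E)%E.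
Proof.
transitivity (c%:E * P setT)%E; first exact: integral_cst.
by rewrite probability_setT mule1.
Qed.

Lemma measurable_le_cst f (c : R) : measurable_fun setT f ->
  measurable [set w | f w <= c].
Proof.
move=> mf; rewrite -[X in measurable X]setTI.
have -> : [set w | f w <= c] = f @^-1` `]-oo, c].
  by apply/seteqP; split => w /=; rewrite in_itv.
exact: mf.
Qed.

Lemma measurable_lt_cst f (c : R) : measurable_fun setT f ->
  measurable [set w | f w < c].
Proof.
move=> mf; rewrite -[X in measurable X]setTI.
have -> : [set w | f w < c] = f @^-1` `]-oo, c[.
  by apply/seteqP; split => w /=; rewrite in_itv.
exact: mf.
Qed.

Lemma prob_nonincreasing_small (F : nat -> set Omega) (e : R) :
  (forall n, measurable (F n)) -> (forall n, F n.+1 `<=` F n) ->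
  P (\bigcap_n F n) = 0%E -> 0 < e -> exists n, prob (F n) < e.
Proof.
move=> mF niF F0 e0.
have : P \o F @ \oo --> P (\bigcap_n F n).
  apply: nonincreasing_cvg_mu => //.
  - by rewrite ltey_eq fin_num_measure.
  - exact: bigcap_measurable.
  - by apply/nonincreasing_seqP => n; apply/subsetPset/niF.
rewrite F0 => /fine_cvgP[_ /cvgrPdist_lt /(_ _ e0)[N _ /(_ N (leqnn N))]] /=.
by rewrite sub0r normrN ger0_norm ?prob_ge0// => ?; exists N.
Qed.

Lemma integral_EFin_le f g :
  measurable_fun setT f -> measurable_fun setT g ->
  (forall w, 0 <= f w) -> (forall w, f w <= g w) ->
  (\int[P]_w (f w)%:E <= \int[P]_w (g w)%:E)%E.
Proof.
move=> mf mg f0 fg; apply: ge0_le_integral => //.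
- by move=> w _; rewrite lee_fin.
- exact/measurable_EFinP.
- exact/measurable_EFinP.
- by move=> w _; rewrite lee_fin.
Qed.

(** * Functions of a finite-valued random variable *)

Section finite_partition.
Context {F : finType}.
Variable pi : Omega -> F.
Hypothesis mpi : forall s, measurable (pi @^-1` [set s]).

Lemma measurable_fibres (Q : set F) : measurable (pi @^-1` Q).
Proof.
have -> : pi @^-1` Q = \bigcup_(s in Q) (pi @^-1` [set s]).
  by apply/seteqP; split => [w Qw|w [s Qs /= ->]//]; exists (pi w).
by apply: fin_bigcup_measurable => // s _.
Qed.

Lemma measurable_fun_fibres d' (X : measurableType d') (G : F -> Omega -> X) :
  (forall s, measurable_fun setT (G s)) ->
  measurable_fun setT (fun w => G (pi w) w).
Proof.
move=> mG _ Y mY; rewrite setTI.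
have -> : (fun w => G (pi w) w) @^-1` Y =
    \bigcup_(s in [set: F]) (pi @^-1` [set s] `&` (G s @^-1` Y)).
  apply/seteqP; split => [w Yw|w [s _ [/= ->]]//].
  by exists (pi w).
apply: fin_bigcup_measurable => // s _; apply: measurableI => //.
by rewrite -[X in measurable X]setTI; exact: mG.
Qed.

Lemma integral_fibres (x : F -> R) : (forall s, 0 <= x s) ->
  (\int[P]_w (x (pi w))%:E = (\sum_s x s * prob (pi @^-1` [set s]))%:E)%E.
Proof.
move=> x0.
transitivity (\int[P]_w (\sum_(s <- index_enum F)
    (x s * \1_(pi @^-1` [set s]) w)%:E))%E.
  apply: eq_integral => w _; rewrite sumEFin; congr EFin.
  rewrite (bigD1 (pi w))//= big1 ?addr0 ?indicE ?mem_set ?mulr1//.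
  move=> s sw; rewrite indicE memNset ?mulr0//= => /esym/eqP.
  by rewrite (negbTE sw).
rewrite ge0_integral_sum//.
- rewrite -sumEFin; apply: eq_bigr => s _.
  under eq_integral do rewrite EFinM.
  rewrite ge0_integralZl_EFin//.
  + rewrite integral_indic// setIT EFinM; congr (_ * _)%E; exact: probE.
  + by apply/measurable_EFinP; exact: measurable_indic.
- move=> s; apply/measurable_EFinP; apply: measurable_funM; first exact: measurable_cst.
  exact: measurable_indic.
- by move=> s w _; rewrite lee_fin mulr_ge0.
Qed.

Lemma prob_fibres (Q : pred F) :
  prob [set w | Q (pi w)] = \sum_(s | Q s) prob (pi @^-1` [set s]).
Proof.
have mQ : measurable [set w | Q (pi w)] by exact: (measurable_fibres (fun s => Q s)).
apply: EFin_inj; rewrite -probE// -(setIT [set w | _]) -integral_indic//.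
transitivity (\int[P]_w (Q (pi w))%:R%:E)%E.
  apply: eq_integral => w _; rewrite indicE; congr (_%:R%:E).
  by congr nat_of_bool; apply/idP/idP; rewrite inE.
rewrite (integral_fibres (fun s => (Q s)%:R))//; congr EFin.
by rewrite [RHS]big_mkcond/=; apply: eq_bigr => s _; case: (Q s); rewrite ?mul1r ?mul0r.
Qed.

End finite_partition.
End Probability.

(** * Ergodic averages *)

Section Ergodic.
Context {R : realType} {d : measure_display} {Omega : measurableType d}.
Variables (P : probability Omega R) (T : Omega -> Omega).
Hypothesis mT : measurable_fun [set: Omega] T.
Hypothesis PT : forall A, measurable A -> P (T @^-1` A) = P A.

Lemma measurable_iter t : measurable_fun [set: Omega] (iter t T).
Proof.
elim: t => [|t IH]; first exact: measurable_id.
exact: (measurableT_comp mT IH).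
Qed.

Lemma measurable_preimage_iter t A : measurable A ->
  measurable (iter t T @^-1` A).
Proof. by move=> mA; rewrite -[X in measurable X]setTI; exact: measurable_iter. Qed.

Lemma measure_preimage_iter t A : measurable A -> P (iter t T @^-1` A) = P A.
Proof.
elim: t A => [//|t IH] A mA; rewrite -[RHS](PT _ mA).
by apply: (IH (T @^-1` A)); rewrite -[X in measurable X]setTI; exact: mT.
Qed.

Lemma ge0_integral_iter t (f : Omega -> R) :
  measurable_fun setT f -> (forall w, 0 <= f w) ->
  (\int[P]_w (f (iter t T w))%:E = \int[P]_w (f w)%:E)%E.
Proof.
move=> mf f0.
have mEf : measurable_fun setT (EFin \o f) by exact/measurable_EFinP.
have Ef0 : {in setT, forall w, (0 <= (EFin \o f) w)%E}.
  by move=> w _; rewrite lee_fin.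
have := ge0_integral_pushforward (measurable_iter t) P measurableT mEf Ef0.
rewrite preimage_setT /= => <-.
apply: eq_measure_integral; first exact: measurable_iter.
by move=> mi A mA _; exact: measure_preimage_iter.
Qed.

Definition birkhoff_sum (f : Omega -> R) n w : R := \sum_(t < n) f (iter t T w).

Lemma birkhoff_sumD f m n w :
  birkhoff_sum f (m + n) w = birkhoff_sum f m w + birkhoff_sum f n (iter m T w).
Proof.
rewrite /birkhoff_sum big_split_ord/=; congr (_ + _).
by apply: eq_bigr => t _; rewrite addnC iterD.
Qed.

Lemma birkhoff_sumS f n w : birkhoff_sum f n.+1 w = f w + birkhoff_sum f n (T w).
Proof. by rewrite -add1n birkhoff_sumD /birkhoff_sum big_ord1. Qed.

Lemma measurable_birkhoff_sum f n :
  measurable_fun setT f -> measurable_fun setT (birkhoff_sum f n).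
Proof.
move=> mf; apply: measurable_sum => t.
exact: (measurableT_comp mf (measurable_iter t)).
Qed.

Lemma birkhoff_sum_ge0 (f : Omega -> R) n w : (forall w, 0 <= f w) -> 0 <= birkhoff_sum f n w.
Proof. by move=> f0; apply: sumr_ge0. Qed.

Lemma birkhoff_sum_le (f : Omega -> R) n w (B : R) : (forall w, f w <= B) ->
  birkhoff_sum f n w <= n%:R * B.
Proof.
move=> fB; rewrite mulr_natl -[leRHS]/(B *+ n) -[in leRHS](card_ord n) -sumr_const.
exact: ler_sum.
Qed.

(* Cut the orbit greedily into blocks of length at most [M] on which the average
   of [f] is below [q]; points without such a block are bounded by [B]. *)
Lemma birkhoff_sum_cover (f : Omega -> R) (B q : R) (M : nat) (D : set Omega) :
  (forall w, 0 <= f w) -> (forall w, f w <= B) -> 0 <= q ->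
  (forall w, ~ D w -> exists2 n, (0 < n <= M)%N & birkhoff_sum f n w <= n%:R * q) ->
  forall L w, birkhoff_sum f L w <=
    L%:R * q + M%:R * B + B * birkhoff_sum (\1_D) L w.
Proof.
move=> f0 fB q0 HD L; have [m] := ubnP L; elim: m L => // m IH L Lm w.
have B0 : 0 <= B by exact: le_trans (fB w).
have i0 v : 0 <= (\1_D v : R) by rewrite indicE.
(* A final stretch no longer than one block is charged to the constant [M%:R * B]. *)
have [LM|ML] := leqP L M.
  apply: (le_trans (birkhoff_sum_le _ _ _ _ fB)).
  have : L%:R * B <= M%:R * B by rewrite ler_wpM2r// ler_nat.
  have : 0 <= B * birkhoff_sum (\1_D) L w by rewrite mulr_ge0// birkhoff_sum_ge0.
  have : 0 <= L%:R * q by rewrite mulr_ge0.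
  lra.
have [Dw|nDw] := pselect (D w).
  case: L Lm ML => [//|L] Lm ML; rewrite !birkhoff_sumS.
  have := IH L Lm (T w); have := fB w.
  rewrite [\1_D w]indicE mem_set// mulrDr mulr1 -natr1 mulrDl mul1r.
  lra.
have [n /andP[n0 nM] Hn] := HD _ nDw.
have -> : L = (n + (L - n))%N by rewrite subnKC// ltnW// (leq_ltn_trans nM).
rewrite !birkhoff_sumD.
have := IH (L - n)%N _ (iter n T w).
have -> : (L - n < m)%N.
  by rewrite (leq_trans _ (_ : L <= m)%N)// ltn_subrL n0 (leq_ltn_trans _ ML).
move=> /(_ isT).
have : 0 <= B * birkhoff_sum (\1_D) n w by rewrite mulr_ge0// birkhoff_sum_ge0.
by rewrite natrD; lra.
Qed.

Lemma integral_birkhoff_sum (f : Omega -> R) (e : R) L :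
  measurable_fun setT f -> (forall w, 0 <= f w) ->
  (\int[P]_w (f w)%:E = e%:E)%E ->
  (\int[P]_w (birkhoff_sum f L w)%:E = (L%:R * e)%:E)%E.
Proof.
move=> mf f0 fe; under eq_integral do rewrite /birkhoff_sum -sumEFin.
rewrite ge0_integral_sum//.
- under eq_bigr do rewrite ge0_integral_iter// fe.
  by rewrite sumEFin sumr_const card_ord mulr_natl.
- move=> t; apply/measurable_EFinP.
  exact: (measurableT_comp mf (measurable_iter t)).
- by move=> t w _; rewrite lee_fin.
Qed.

Hypothesis ergT : forall A, measurable A -> T @^-1` A = A ->
  P A = 0%E \/ P A = 1%E.

(** The event [A] that the averages fall below [q] by a fixed margin infinitely often is invariant,
    hence has probability 0 or 1. If it had probability 1, almost every point would start a block of
    average at most [q], of length at most [M] outside a rare event [D M]. Integrating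
    [birkhoff_sum_cover] would then push the mean of [f] below its actual value. *)
Lemma birkhoff_lower (f : Omega -> R) (B q : R) :
  measurable_fun setT f -> (forall w, 0 <= f w) -> (forall w, f w <= B) ->
  (q%:E < \int[P]_w (f w)%:E)%E ->
  {ae P, forall w, forall e : R, 0 < e -> exists N : nat, forall n, (N <= n)%N ->
    q - e <= n%:R^-1 * birkhoff_sum f n w}.
Proof.
move=> mf f0 fB qf.
have [q0|q0] := leP q 0.
  apply: aeW => w e e0; exists 0%N => n _; apply: (@le_trans _ _ 0); first by lra.
  by rewrite mulr_ge0 ?birkhoff_sum_ge0.
pose E (m n : nat) := [set w | birkhoff_sum f n w < n%:R * (q - m.+1%:R^-1)].
pose A := \bigcup_m \bigcap_N \bigcup_(n in [set n | (N <= n)%N]) E m n.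
have mA : measurable A.
  apply: bigcup_measurable => m _; apply: bigcap_measurable => // N _.
  apply: bigcup_measurable => n _; apply: measurable_lt_cst.
  exact: measurable_birkhoff_sum.
have half m : (m.*2.+1.+1%:R : R) = 2 * m.+1%:R.
  by rewrite -doubleS -mul2n natrM.
(* A shift changes the sum by one value in [0, [B]] and the number of terms by one. For large [n]
   half of the margin absorbs this, and [m.*2.+1] is the index whose margin is half of that of
   [m]. *)
have TA : T @^-1` A = A.
  apply/seteqP; split => w [m _ Am]; exists m.*2.+1 => // N _.
  - have [n /= + En] := Am (N + (Num.truncn ((B + 1) * m.*2.+2%:R)).+1)%N I.
    move=> nN; exists n.+1; first by rewrite /= (leq_trans _ (leqW nN))// leq_addr.
    move: En; rewrite /E /= birkhoff_sumS.
    have : (B + 1) * m.*2.+2%:R <= n%:R.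
      apply: ltW; apply: lt_le_trans (truncnS_gt _) _.
      by rewrite ler_nat (leq_trans _ nN)// leq_addl.
    rewrite half => Bn.
    have d0 : 0 < m.+1%:R^-1 :> R by rewrite invr_gt0.
    have d1 : m.+1%:R^-1 <= 1 :> R by rewrite invf_le1// ler1n.
    have Bn' : 2 * (B + 1) <= n%:R * m.+1%:R^-1.
      by rewrite ler_pdivlMr//; lra.
    rewrite invfM -[n.+1%:R]natr1; have := fB w; move: d0 d1 Bn'.
    move: (m.+1%:R^-1) => x; move: (birkhoff_sum _ _ _) (f w) (n%:R) => u v y.
    nra.
  - have [n /= + En] := Am (N.+1 + (Num.truncn (q * m.*2.+2%:R)).+1)%N I.
    case: n En => [//|n] En nN; exists n.
      by rewrite /= -ltnS (leq_trans _ nN)// leq_addr.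
    move: En; rewrite /E /= birkhoff_sumS.
    have : q * m.*2.+2%:R <= n%:R.
      apply: ltW; apply: lt_le_trans (truncnS_gt _) _.
      by rewrite ler_nat -ltnS (leq_trans _ nN)// addSn ltnS leq_addl.
    rewrite half => Bn.
    have d0 : 0 < m.+1%:R^-1 :> R by rewrite invr_gt0.
    have Bn' : 2 * q <= n%:R * m.+1%:R^-1.
      by rewrite ler_pdivlMr//; lra.
    rewrite invfM -[n.+1%:R]natr1; have := f0 w; move: d0 Bn'.
    move: (m.+1%:R^-1) => x; move: (birkhoff_sum _ _ _) (f w) (n%:R) => u v y.
    nra.
have [PA0|PA1] := ergT _ mA TA.
  exists A; split => // w /= nAw; apply: contrapT => nA; apply: nAw => e e0.
  pose m := Num.truncn e^-1.
  have me : m.+1%:R^-1 < e.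
    by rewrite invf_plt ?posrE// truncnS_gt.
  apply: contrapT => H; apply: nA; exists m => // N _; apply: contrapT => H'.
  apply: H; exists N.+1 => n Nn; rewrite leNgt; apply/negP => H.
  apply: H'; exists n; first exact: ltnW.
  have n0 : (0 < n)%N by exact: leq_ltn_trans Nn.
  rewrite /E /=; apply: (@lt_le_trans _ _ (n%:R * (q - e))).
    by rewrite mulrC -ltr_pdivrMr ?ltr0n// mulrC.
  by rewrite ler_wpM2l// lerB// ltW.
exfalso.
pose D M := [set w | forall n, (0 < n <= M)%N -> n%:R * q < birkhoff_sum f n w].
have mD M : measurable (D M).
  have -> : D M = \bigcap_(n in [set n | (0 < n <= M)%N])
      ~` [set w | birkhoff_sum f n w <= n%:R * q].
    apply/seteqP; split => w /= H n /= /H; first by move=> ?; apply/negP; rewrite -ltNge.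
    by move=> /negP; rewrite -ltNge.
  apply: bigcap_measurableType.
  move=> n _; apply: measurableC; apply: measurable_le_cst.
  exact: measurable_birkhoff_sum.
have D0 : P (\bigcap_M D M) = 0%E.
  have mbD : measurable (\bigcap_M D M) by exact: bigcapT_measurable.
  apply/eqP; rewrite eq_le measure_ge0 andbT.
  have <- : P (~` A) = 0%E by rewrite probability_setC// PA1 subee.
  apply: le_measure; rewrite ?inE//; first exact: measurableC.
  move=> w Dw [m _ /(_ 1%N I)[n /= n1]]; rewrite /E /= => H.
  have := Dw n I n; rewrite n1 leqnn => /(_ isT).
  have : 0 <= n%:R * m.+1%:R^-1 :> R by [].
  move: H; rewrite mulrBr; move: (n%:R * _^-1) => u; lra.
have B0 : 0 <= B.
  have [w _] : [set: Omega] !=set0.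
    apply/set0P/negP => /eqP H; have := probability_setT P.
    by rewrite H measure0 => /esym/eqP; rewrite onee_eq0.
  exact: le_trans (fB w).
have [e fe] : exists e : R, (\int[P]_w (f w)%:E = e%:E)%E.
  exists (fine (\int[P]_w (f w)%:E)%E); rewrite fineK// ge0_fin_numE.
    apply: le_lt_trans (ltry B).
    rewrite -(integral_probability_cst P).
    by apply: integral_EFin_le => //; exact: measurable_cst.
  by apply: integral_ge0 => w _; rewrite lee_fin.
move: qf; rewrite fe lte_fin => qe.
have niD M : D M.+1 `<=` D M.
  by move=> w H n /andP[n0 nM]; apply: H; rewrite n0 leqW.
(* Makes the contribution of [D M] at most half of the gap [e - q]; the [+ 1] guards against
   [B = 0]. *)
have eps0 : 0 < (e - q) / (2 * (B + 1)) by rewrite divr_gt0//; lra.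
have [M DM] := prob_nonincreasing_small P D _ mD niD D0 eps0.
have bound L : L%:R * e <= L%:R * q + M%:R * B + B * (L%:R * prob P (D M)).
  have := birkhoff_sum_cover f B q M (D M) f0 fB (ltW q0) _ L.
  have H : forall w, ~ D M w ->
      exists2 n, (0 < n <= M)%N & birkhoff_sum f n w <= n%:R * q.
    move=> w nD; apply: contrapT => H; apply: nD => n nM.
    by rewrite ltNge; apply/negP => H'; apply: H; exists n.
  move=> /(_ H) {}H.
  rewrite -lee_fin -(integral_birkhoff_sum f e L mf f0 fe).
  have i0 v : 0 <= (\1_(D M) v : R) by rewrite indicE.
  have mi : measurable_fun setT (\1_(D M) : Omega -> R) by exact: measurable_indic.
  have ie : (\int[P]_w (\1_(D M) w)%:E = (prob P (D M))%:E)%E.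
    by rewrite integral_indic// setIT; exact: probE.
  have mB : measurable_fun setT (fun w => B * birkhoff_sum (\1_(D M)) L w).
    apply: measurable_funM; first exact: measurable_cst.
    exact: measurable_birkhoff_sum.
  have c0 : 0 <= L%:R * q + M%:R * B by rewrite addr_ge0 ?mulr_ge0// ltW.
  apply: (@le_trans _ _
      (\int[P]_w (L%:R * q + M%:R * B + B * birkhoff_sum (\1_(D M)) L w)%:E)%E).
    apply: integral_EFin_le => //; first exact: measurable_birkhoff_sum.
      by apply: measurable_funD => //; exact: measurable_cst.
    by move=> w; exact: birkhoff_sum_ge0.
  under eq_integral do rewrite EFinD.
  rewrite ge0_integralD//.
  - rewrite integral_probability_cst [leRHS]EFinD; apply: leeD2l.
    under eq_integral do rewrite EFinM.
    rewrite ge0_integralZl_EFin//.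
    + by rewrite (integral_birkhoff_sum _ _ _ mi i0 ie) EFinM.
    + by move=> w _; rewrite lee_fin birkhoff_sum_ge0.
    + by apply/measurable_EFinP; exact: measurable_birkhoff_sum.
  - by move=> w _; rewrite lee_fin mulr_ge0// birkhoff_sum_ge0.
  - exact/measurable_EFinP.
(* Beyond this horizon the boundary term [M%:R * B] is less than [L%:R] times the other half of the
   gap. *)
pose x := 2 * (M%:R * B) / (e - q).
have := bound (Num.truncn x).+1; have : x < (Num.truncn x).+1%:R := truncnS_gt x.
have := ler0n R (Num.truncn x).+1; move: (_.+1%:R) => u u0; rewrite {}/x ltr_pdivrMr; last lra.
have := DM; rewrite ltr_pdivlMr; last lra.
move: (prob_ge0 P (D M)); move: (prob _ _) (M%:R * B) => p v.
move=> p0 DMp H1 H2.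
have Bp : B * p <= (e - q) / 2 by nra.
have := ler_wpM2l u0 Bp; nra.
Qed.
End Ergodic.

(** * Splitting events by the first gain *)

Section Splitting.
Context {R : realType} {d : measure_display} {Omega : measurableType d}.
Variables (P : probability Omega R) (H : Omega -> R * R) (s1 : R).
Hypothesis mH : measurable_fun [set: Omega] H.
Hypothesis cdfH1 : forall x, 0 <= x ->
  P [set w | (H w).1 <= x] = (1 - expR (- x ^+ 2 / (2 * s1 ^+ 2)))%:E.

Lemma measurable_preimage_gain (A : set (R * R)) :
  measurable A -> measurable (H @^-1` A).
Proof. by move=> mA; rewrite -[X in measurable X]setTI; exact: mH. Qed.

Let mfst_le (x : R) : measurable [set h : R * R | h.1 <= x].
Proof. exact: (measurable_le_cst _ _ measurable_fst). Qed.

Let G (x : R) : R := 1 - expR (- x ^+ 2 / (2 * s1 ^+ 2)).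

Let continuous_G : continuous G.
Proof.
move=> x; rewrite /G; apply: cvgB; first exact: cvg_cst.
apply: continuous_comp; last exact: continuous_expR.
apply: cvgM; last exact: cvg_cst.
apply: cvgN; exact: exprn_continuous.
Qed.

Let prob_fst x : 0 <= x -> prob P (H @^-1` [set h | h.1 <= x]) = G x.
Proof. by move=> x0; rewrite /prob /= cdfH1. Qed.

(** Cutting [A] at a level of the first gain gives a probability whose increments are bounded by
    those of the continuous distribution function [G]; it is thus continuous in the level and takes
    all intermediate values. *)
Lemma split_event (A : set (R * R)) (w : R) : measurable A ->
  0 <= w <= prob P (H @^-1` A) ->
  exists B, [/\ measurable B, B `<=` A & prob P (H @^-1` B) = w].
Proof.
(* The full probability need not be attained at a finite level, so in that case [A] itself is
   taken. *)
move=> mA /andP[w0]; rewrite le_eqVlt => /predU1P[->|wA]; first by exists A; split.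
pose S x := [set h : R * R | h.1 <= x].
have msS x : measurable (S x) by exact: mfst_le.
(* The law is given at nonnegative levels only. As [G] is even, the absolute value extends the
   comparison with [G] to the whole line. *)
pose F (x : R) := prob P (H @^-1` (A `&` S `|x|)).
have mAS x : measurable (H @^-1` (A `&` S x)).
  by apply: measurable_preimage_gain; exact: measurableI.
have mS x : measurable (H @^-1` S x) by apply: measurable_preimage_gain.
have FG (x y : R) : `|x| <= `|y| -> 0 <= F y - F x <= G y - G x.
  move=> xy; have := mAS `|x|; have := mAS `|y|; have := mS `|x|; have := mS `|y|.
  have -> : G y = prob P (H @^-1` S `|y|).
    by rewrite prob_fst// /G real_normK ?num_real.
  have -> : G x = prob P (H @^-1` S `|x|).
    by rewrite prob_fst// /G real_normK ?num_real.
  move=> my mx mAy mAx; apply/andP; split.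
    rewrite subr_ge0; apply: prob_le => // w' [? Sx]; split=> //.
    exact: le_trans xy.
  have E (C D : set Omega) : measurable C -> measurable D -> C `<=` D ->
      prob P D = prob P C + prob P (D `\` C).
    move=> mC mD CD; rewrite -probU ?setDUK//; first exact: measurableD.
    by rewrite setDIK.
  rewrite /F (E (H @^-1` (A `&` S `|x|)) (H @^-1` (A `&` S `|y|)))//; last first.
    by move=> w' [? Sx]; split => //; exact: le_trans xy.
  rewrite (E (H @^-1` S `|x|) (H @^-1` S `|y|))//; last first.
    by move=> w' Sx; exact: le_trans xy.
  rewrite !(addrC (prob P _) (prob P (_ `\` _))) !addrK.
  apply: prob_le; [exact: measurableD|exact: measurableD|].
  by move=> w' [[Aw Sy] nS]; split => // Sx; exact: nS.
have cF : continuous F.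
  move=> x; apply/cvgrPdist_lt => e e0.
  have /cvgrPdist_lt/(_ e e0) := continuous_G x.
  apply: filterS => y; apply: le_lt_trans.
  have [xy|/ltW yx] := leP `|x| `|y|.
    have /andP[F0 FGle] := FG _ _ xy.
    by rewrite distrC ger0_norm// distrC ger0_norm// (le_trans F0).
  have /andP[F0 FGle] := FG _ _ yx.
  by rewrite ger0_norm// ger0_norm// (le_trans F0).
have [n Hn] : exists n : nat, w < F n%:R.
  have mD n : measurable (H @^-1` (A `\` S n%:R)).
    by apply: measurable_preimage_gain; exact: measurableD.
  have niD n : H @^-1` (A `\` S n.+1%:R) `<=` H @^-1` (A `\` S n%:R).
    move=> w' [Aw nS]; split => // Sn; apply: nS.
    by apply: le_trans Sn _; rewrite ler_nat.
  have e0 : 0 < prob P (H @^-1` A) - w by rewrite subr_gt0.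
  have D0 : P (\bigcap_n H @^-1` (A `\` S n%:R)) = 0%E.
    rewrite (_ : \bigcap_n _ = set0) ?measure0//.
    apply/seteqP; split => // w' /(_ (Num.truncn (H w').1).+1 I)[_]; apply.
    by rewrite /S /= ltW// truncnS_gt.
  have [n] := prob_nonincreasing_small P (fun n => H @^-1` (A `\` S n%:R)) _ mD niD D0 e0.
  move=> small; exists n; move: small; rewrite /F ger0_norm ?ler0n//.
  have -> : prob P (H @^-1` A) =
      prob P (H @^-1` (A `&` S n%:R)) + prob P (H @^-1` (A `\` S n%:R)).
    rewrite -probU//; last by apply/seteqP; split => // ? [[_ ?] [_ []]].
    by congr (prob P _); rewrite -preimage_setU setUIDK.
  lra.
have F0 : F 0 = 0.
  apply/eqP; rewrite eq_le prob_ge0 andbT /F normr0.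
  apply: (@le_trans _ _ (prob P (H @^-1` S 0))).
    by apply: prob_le => // w' [].
  by rewrite prob_fst// /G expr0n/= oppr0 mul0r expR0 subrr.
have [|||x _ Fx] := @IVT R F 0 n%:R w.
- exact: ler0n.
- exact: continuous_subspaceT.
- by rewrite F0 ge_min w0/= le_max (ltW Hn) orbT.
exists (A `&` S `|x|); split => //; first exact: measurableI.
Qed.

(** The first weight is cut off [A]; the remainder still has enough probability for the other
    weights, so induction applies to it. *)
Lemma split_family (I : eqType) (s : seq I) (w : I -> R) (A : set (R * R)) :
  measurable A -> uniq s -> (forall i, 0 <= w i) ->
  \sum_(i <- s) w i <= prob P (H @^-1` A) ->
  exists B : I -> set (R * R),
    [/\ forall i, measurable (B i) /\ B i `<=` A,
        forall i j h, B i h -> B j h -> i = j,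
        forall i, i \in s -> prob P (H @^-1` B i) = w i &
        forall i, i \notin s -> B i = set0].
Proof.
move=> + + w0; elim: s A => [|i s IH] A mA.
  by move=> _ _; exists (fun=> set0); split=> //; split.
move=> /= /andP[ins us]; rewrite big_cons => sumA.
have sum0 : 0 <= \sum_(j <- s) w j by apply: sumr_ge0.
have [|B0 [mB0 B0A PB0]] := split_event A (w i) mA.
  by rewrite w0/=; lra.
have PD : prob P (H @^-1` A) = w i + prob P (H @^-1` (A `\` B0)).
  rewrite -PB0 -probU.
  - by rewrite -preimage_setU setDUK.
  - exact: measurable_preimage_gain.
  - by apply: measurable_preimage_gain; exact: measurableD.
  - by rewrite -preimage_setI setDIK preimage_set0.
have [|||B [mB dB PB B0s]] := IH (A `\` B0).
- exact: measurableD.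
- exact: us.
- by move: sumA; rewrite PD; lra.
exists (fun j => if j == i then B0 else B j); split.
- move=> j; case: eqP => [_|_]; first by split.
  by have [? BA] := mB j; split=> // h /BA[].
- move=> j k h; case: eqP => [->|_]; case: eqP => [->//|_] Bj Bk.
  + by have [_ /(_ _ Bk)[_]] := mB k.
  + by have [_ /(_ _ Bj)[_]] := mB j.
  + exact: dB Bj Bk.
- move=> j; rewrite inE; case: eqP => [->//|_] /= js; exact: PB.
- by move=> j; rewrite inE; case: eqP => //= _ js; exact: B0s.
Qed.

(** The letter [i0] is a default filling the bad cells and whatever the other letters leave of a
    good cell, so its own weight is not prescribed and weights summing to less than the cell are
    allowed. *)
Lemma realize_weights (K I : finType) (cell : R * R -> K) (good : pred K)
    (i0 : I) (w : K -> I -> R) :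
  (forall k, measurable (cell @^-1` [set k])) ->
  (forall k i, 0 <= w k i) ->
  (forall k, \sum_i w k i <= prob P (H @^-1` (cell @^-1` [set k]))) ->
  exists f : R * R -> I,
    [/\ forall i, measurable (f @^-1` [set i]),
        forall h, ~~ good (cell h) -> f h = i0 &
        forall k i, good k -> i != i0 ->
          prob P [set v | cell (H v) = k /\ f (H v) = i] = w k i].
Proof.
move=> mcell w0 wle.
pose s k := if good k then [seq i <- enum I | i != i0] else [::].
have us k : uniq (s k) by rewrite /s; case: ifP => // _; rewrite filter_uniq ?enum_uniq.
have ws k : \sum_(i <- s k) w k i <= prob P (H @^-1` (cell @^-1` [set k])).
  apply: le_trans (wle k); rewrite /s; case: ifP => _; last first.
    by rewrite big_nil sumr_ge0.
  rewrite big_filter big_enum_cond/= [leRHS](bigID (fun i => i != i0))/=.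
  by rewrite lerDl sumr_ge0.
have [B HB] := choice (fun k => split_family _ _ _ _ (mcell k) (us k) (w0 k) (ws k)).
have BN k i h : B k i h -> good k /\ i != i0.
  have [_ _ _ N] := HB k; move=> Bh.
  have : i \in s k by apply/negPn/negP => /N is0; rewrite is0 in Bh.
  by rewrite /s; case: ifP => // _; rewrite mem_filter => /andP[].
pose f h := odflt i0 [pick i | `[< B (cell h) i h >]].
have fB h i : i != i0 -> f h = i <-> B (cell h) i h.
  move=> ii0; rewrite /f; case: pickP => [j /asboolP Bj|N]; split => /=.
  - by move=> <-.
  - by move=> Bi; have [_ dB _ _] := HB (cell h); exact: dB Bj Bi.
  - by move=> e; rewrite e eqxx in ii0.
  - by move=> /asboolP; rewrite N.
have mf1 i : i != i0 -> measurable (f @^-1` [set i]).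
  move=> ii0.
  have -> : f @^-1` [set i] = \bigcup_(k in [set: K]) B k i.
    apply/seteqP; split => h /=.
      by move=> /(fB _ _ ii0) Bh; exists (cell h).
    move=> [k _ Bh]; apply/fB => //.
    by have [/(_ i)[_ /(_ _ Bh) /= -> //]] := HB k.
  apply: fin_bigcup_measurable => // k _.
  by have [/(_ i)[]] := HB k.
exists f; split.
- move=> i; have [->|] := eqVneq i i0; last exact: mf1.
  have -> : f @^-1` [set i0] = ~` \bigcup_(i in [set i | i != i0]) (f @^-1` [set i]).
    apply/seteqP; split => h /=; first by move=> fh [j /= j0 fj]; rewrite -fj fh eqxx in j0.
    by move=> N; apply: contrapT => /eqP fh; apply: N; exists (f h).
  apply: measurableC; apply: fin_bigcup_measurable; first exact: finite_finset.
  by move=> j; exact: mf1.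
- move=> h nh; rewrite /f; case: pickP => //= j /asboolP /BN[].
  by rewrite (negbTE nh).
- move=> k i gk ii0; have [mB _ PB _] := HB k.
  rewrite -PB; last by rewrite /s gk mem_filter ii0 mem_enum.
  congr (prob P _); apply/seteqP; split => v /=.
    by move=> [<-] /fB; exact.
  move=> Bv; have ck : cell (H v) = k by have [_ /(_ _ Bv)] := mB i.
  by split=> //; apply/fB => //; rewrite ck.
Qed.

End Splitting.

(** * Frequencies of the rate pairs *)

Section Averaging.
Context {R : realType} {d : measure_display} {Omega : measurableType d}.
Variables (P : probability Omega R) (T : Omega -> Omega) (H : Omega -> R * R).
Hypothesis mT : measurable_fun [set: Omega] T.
Hypothesis PT : forall A, measurable A -> P (T @^-1` A) = P A.
Hypothesis mH : measurable_fun [set: Omega] H.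
Variables (K J : finType) (cell : R * R -> K) (i0 : J) (C : K -> J -> R).
Hypothesis mcell : forall k, measurable (cell @^-1` [set k]).
Hypothesis C_ge0 : forall k i, 0 <= C k i.
Hypothesis C_i0 : forall k, C k i0 = 0.
Variables (rho1 rho2 : J -> R) (s : nat -> Omega -> R) (Pt : R).
Hypothesis rho1_ge0 : forall i, 0 <= rho1 i.
Hypothesis rho2_ge0 : forall i, 0 <= rho2 i.
Hypothesis ms : forall t, measurable_fun [set: Omega] (s t).
Hypothesis s_ge0 : forall t w, 0 <= s t w.
Hypothesis s_le : forall t, (\int[P]_w (s t w)%:E <= Pt%:E)%E.
Variable r : nat -> Omega -> J.
Hypothesis Cs : forall t w, C (cell (H (iter t T w))) (r t w) <= s t w.

Let kt t w := cell (H (iter t T w)).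

Let mkt t k : measurable [set w | kt t w = k].
Proof.
apply: (measurable_preimage_iter T mT t (H @^-1` (cell @^-1` [set k]))).
exact: measurable_preimage_gain.
Qed.

Let profile n (w : Omega) : {ffun 'I_n -> K * {set J}} :=
  [ffun t : 'I_n => (kt t w, [set i | C (kt t w) i <= s t w]%SET)].

Let measurable_profile n q : measurable (profile n @^-1` [set q]).
Proof.
have -> : profile n @^-1` [set q] = \bigcap_(t in [set: 'I_n])
    ([set w | kt t w = (q t).1] `&` \bigcap_(i in [set: J])
      [set w | (C (q t).1 i <= s t w) = (i \in (q t).2)]).
  apply/seteqP; split => w /=.
    move=> <- t _; rewrite /profile ffunE /=; split => // i _.
    by rewrite /= inE.
  move=> E; apply/ffunP => t; rewrite /profile ffunE.
  have [/= kE iE] := E t I; rewrite kE; case: (q t) kE iE => a b /= kE iE.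
  by congr pair; apply/setP => i; rewrite inE iE.
apply: fin_bigcap_measurable; first exact: finite_finset.
move=> t _; apply: measurableI; first exact: mkt.
apply: fin_bigcap_measurable; first exact: finite_finset.
move=> i _; have mlt : measurable [set w | s t w < C (q t).1 i].
  exact: measurable_lt_cst.
case: (i \in (q t).2).
  rewrite (_ : mkset _ = ~` [set w | s t w < C (q t).1 i]); first exact: measurableC.
  by apply/seteqP; split => w /=; rewrite leNgt => /negP.
rewrite (_ : mkset _ = [set w | s t w < C (q t).1 i])//.
by apply/seteqP; split => w /=; rewrite ltNge; [move=> -> | move=> /negbTE].
Qed.

(* The rates [r] need not be measurable in [w].  The finite profile records, for
   every slot, the cell and the set of rates affordable at the power spent; replacing
   [r] on each profile by its values at one representative keeps the rates
   affordable and makes them measurable. *)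
Lemma averaged_weights (l1 l2 e : R) : 0 <= l1 -> 0 <= l2 -> 0 < e ->
  {ae P, forall w, forall e : R, 0 < e -> exists N : nat, forall n, (N <= n)%N ->
     l1 - e <= n%:R^-1 * \sum_(t < n) rho1 (r t w) /\
     l2 - e <= n%:R^-1 * \sum_(t < n) rho2 (r t w)} ->
  exists w : K -> J -> R,
    [/\ forall k i, 0 <= w k i,
        forall k, \sum_i w k i = prob P (H @^-1` (cell @^-1` [set k])),
        \sum_k \sum_i w k i * C k i <= Pt,
        l1 - e <= \sum_k \sum_i w k i * rho1 i &
        l2 - e <= \sum_k \sum_i w k i * rho2 i].
Proof.
move=> l10 l20 e0 [Z [mZ Z0 HZ]].
pose e1 := e / 2; have e10 : 0 < e1 by rewrite divr_gt0.
pose G n := [set w | l1 - e1 <= n%:R^-1 * \sum_(t < n) rho1 (r t w) /\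
                     l2 - e1 <= n%:R^-1 * \sum_(t < n) rho2 (r t w)].
(* [G n] depends on [r] and may fail to be measurable; its saturation by profiles is a finite union
   of measurable fibres. *)
pose V n := profile n @^-1` (profile n @` G n).
have mV n : measurable (V n) by apply: measurable_fibres; exact: measurable_profile.
have GV n : G n `<=` V n by move=> w Gw; exists w.
(* Losing an event of probability [e2] lowers a mean rate of at most [l1 + l2] by at most [e1], the
   half of [e] not spent in [G n]. *)
pose e2 := e1 / (1 + l1 + l2).
have e20 : 0 < e2 by rewrite divr_gt0//; lra.
have [n n0 PV] : exists2 n, (0 < n)%N & 1 - e2 < prob P (V n).
  pose F N := ~` \bigcap_(n in [set n | (N < n)%N]) V n.
  have mF N : measurable (F N) by apply: measurableC; exact: bigcap_measurableType.
  have niF N : F N.+1 `<=` F N.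
    by move=> w nV Vw; apply: nV => n /= Nn; apply: Vw; exact: ltnW.
  have F0 : P (\bigcap_N F N) = 0%E.
    apply/eqP; rewrite eq_le measure_ge0 andbT -Z0.
    apply: le_measure; rewrite ?inE//; first exact: bigcapT_measurable.
    move=> w Fw; apply: HZ => /= /(_ _ e10)[N HN].
    apply: (Fw N I) => n /= /ltnW Nn; apply: GV; exact: HN.
  have [N FN] := prob_nonincreasing_small P F e2 mF niF F0 e20.
  exists N.+1 => //; have : prob P (~` V N.+1) <= prob P (F N).
    apply: prob_le => //; first exact: measurableC.
    by move=> w nV Vw; apply: nV; exact: (Vw N.+1 (ltnSn N)).
  by rewrite prob_setC//; lra.
have nR : 0 < n%:R :> R by rewrite ltr0n.
pose Q := {ffun 'I_n -> K * {set J}}.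
(* The rates of one outcome in [G n] are copied to all outcomes of the same profile, so its good
   averages hold on all of [V n]; the other profiles stay silent. *)
have /choice[z Hz] : forall q : Q, exists zq : 'I_n -> J,
    (exists w, [/\ G n w, profile n w = q & forall t, zq t = r t w]) \/
    (~ (profile n @` G n) q /\ forall t, zq t = i0).
  move=> q; have [[w Gw <-]|nq] := pselect ((profile n @` G n) q).
    by exists (fun t => r t w); left; exists w.
  by exists (fun=> i0); right.
pose p (q : Q) := prob P (profile n @^-1` [set q]).
have p0 q : 0 <= p q by exact: prob_ge0.
(* The joint law of cell and modified rate pair at a slot drawn uniformly among the first [n]. *)
pose w k i : R := n%:R^-1 * \sum_(t < n) \sum_(q : Q)
  p q * (((q t).1 == k) && (z q t == i))%:R.
have wX (X : K -> J -> R) : \sum_k \sum_i w k i * X k i =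
    n%:R^-1 * \sum_(t < n) \sum_(q : Q) p q * X (q t).1 (z q t).
  transitivity (\sum_k \sum_i n%:R^-1 * \sum_(t < n) \sum_(q : Q)
      p q * (((q t).1 == k) && (z q t == i))%:R * X k i).
    apply: eq_bigr => k _; apply: eq_bigr => i _; rewrite /w -mulrA; congr (_ * _).
    by rewrite mulr_suml; apply: eq_bigr => t _; rewrite mulr_suml.
  under eq_bigr do rewrite -mulr_sumr exchange_big.
  rewrite -mulr_sumr exchange_big; congr (_ * _); apply: eq_bigr => t _.
  under eq_bigr do rewrite exchange_big.
  rewrite exchange_big; apply: eq_bigr => q _.
  rewrite (bigD1 (q t).1)//= (bigD1 (z q t))//= !eqxx mulr1.
  rewrite big1 ?addr0; last first.
    by move=> i /negbTE; rewrite eq_sym => ->; rewrite mulr0 mul0r.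
  rewrite big1 ?addr0// => k /negbTE; rewrite eq_sym => ->.
  by rewrite big1// => i _; rewrite mulr0 mul0r.
have avg_cst (x : R) : n%:R^-1 * \sum_(t < n) x = x.
  by rewrite sumr_const card_ord -[x *+ n]mulr_natl mulKf// gt_eqF.
have rate_bound (rho : J -> R) l : (forall i, 0 <= rho i) -> 0 <= l -> l <= l1 + l2 ->
    (forall w, G n w -> l - e1 <= n%:R^-1 * \sum_(t < n) rho (r t w)) ->
    l - e <= \sum_k \sum_i w k i * rho i.
  move=> rho0 l0 ll Gl; rewrite (wX (fun _ i => rho i)) exchange_big/= mulr_sumr.
  under eq_bigr do rewrite -mulr_sumr mulrCA.
  rewrite (bigID (fun q => `[< (profile n @` G n) q >]))/=.
  apply: (@le_trans _ _ (\sum_(q | `[< (profile n @` G n) q >]) p q * (l - e1))).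
    rewrite -mulr_suml -(prob_fibres P (profile n) (measurable_profile n)).
    have -> : [set w0 | `[< (profile n @` G n) (profile n w0) >]] = V n.
      by apply/seteqP; split => w' /=; [move/asboolP|move=> ?; apply/asboolP].
    have PV1 : prob P (V n) <= 1.
      by rewrite -(prob_setT P); apply: prob_le.
    have : e2 * (1 + l1 + l2) = e1 by rewrite /e2 divfK// gt_eqF//; lra.
    have : e = e1 + e1 by rewrite /e1; lra.
    by move: PV PV1 e20 e10; move: (prob P (V n)) => v; nra.
  rewrite -[leLHS]addr0; apply: lerD; last first.
    apply: sumr_ge0 => q _; rewrite mulr_ge0// mulr_ge0 ?invr_ge0 ?ler0n//.
    by apply: sumr_ge0.
  apply: ler_sum => q /asboolP Gq; rewrite ler_wpM2l//.
  have [[w' [Gw _ zE]]|[]//] := Hz q.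
  by under eq_bigr do rewrite zE; exact: Gl.
exists w; split.
- move=> k i; rewrite mulr_ge0 ?invr_ge0 ?ler0n//.
  by apply: sumr_ge0 => t _; apply: sumr_ge0 => q _; rewrite mulr_ge0.
- move=> k.
  transitivity (\sum_k' \sum_i w k' i * (k' == k)%:R).
    rewrite (bigD1 k)//= [X in _ + X]big1 ?addr0.
      by apply: eq_bigr => i _; rewrite eqxx mulr1.
    by move=> k' /negbTE ->; rewrite big1// => i _; rewrite mulr0.
  rewrite (wX (fun k' _ => (k' == k)%:R)) -[RHS]avg_cst; congr (_ * _).
  apply: eq_bigr => t _.
  transitivity (prob P [set w' | (profile n w' t).1 == k]).
    rewrite (prob_fibres P (profile n) (measurable_profile n) (fun q => (q t).1 == k)).
    by rewrite [RHS]big_mkcond/=; apply: eq_bigr => q _; case: eqP; rewrite ?mulr1 ?mulr0.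
  transitivity (prob P (iter t T @^-1` (H @^-1` (cell @^-1` [set k])))).
    by congr (prob P _); apply/seteqP; split => w' /=; rewrite /profile ffunE /= => /eqP.
  by rewrite /prob measure_preimage_iter//; exact: measurable_preimage_gain.
- rewrite wX -[leRHS]avg_cst ler_wpM2l ?invr_ge0 ?ler0n//; apply: ler_sum => t _.
  rewrite -lee_fin; apply: le_trans (s_le t).
  under eq_bigr do rewrite mulrC.
  rewrite -(integral_fibres P (profile n) (measurable_profile n)
    (fun q => C (q t).1 (z q t)))//.
  apply: integral_EFin_le => //.
    exact: (measurable_fun_fibres (profile n) (measurable_profile n) _ _
      (fun q _ => C (q t).1 (z q t))).
  (* The representative [v] affords its own rates, and [w'] has the same profile, hence the same
     cells and affordable sets. *)
  move=> w'; have [[v [_ vq zE]]|[_ ->]] := Hz (profile n w'); last by rewrite C_i0.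
  have : r t v \in (profile n v t).2 by rewrite /profile ffunE inE; exact: Cs.
  by rewrite vq zE /profile !ffunE /= inE.
- by apply: rate_bound => //; [lra|move=> w' []].
- by apply: rate_bound => //; [lra|move=> w' []].
Qed.

End Averaging.

(** * Stationary rate maps *)

(** Inversion is discontinuous at 0; the real power of exponent -1 is measurable and agrees with it
    on nonnegative reals, 0 included. *)
Lemma measurable_inv_sqr {R : realType} {d} {X : measurableType d} (u : X -> R) :
  measurable_fun setT u -> measurable_fun setT (fun x => (u x ^+ 2)^-1).
Proof.
move=> mu; have -> : (fun x => (u x ^+ 2)^-1) = (fun y => y `^ (- 1)) \o (fun x => u x ^+ 2).
  by apply/funext => x /=; rewrite powR_inv1// sqr_ge0.
by apply: measurableT_comp; [exact: measurable_powR|exact: measurable_funX].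
Qed.

Section Regions.
Context {R : realType} {d : measure_display} {Omega : measurableType d}.
Variables (P : probability Omega R) (T : Omega -> Omega) (H : Omega -> R * R).
Variables (s1 s2 : R) (Rs : seq R) (Pt : R).
Hypothesis chan : channel_model P T H s1 s2.
Hypothesis Rs_gt0 : forall r, r \in Rs -> 0 < r.

Let mT : measurable_fun [set: Omega] T. Proof. by case: chan. Qed.
Let PT A : measurable A -> P (T @^-1` A) = P A.
Proof. by case: chan => _ [+ _ _ _ _]; exact. Qed.
Let ergT A : measurable A -> T @^-1` A = A -> P A = 0%E \/ P A = 1%E.
Proof. by case: chan => _ [_ + _ _ _]; exact. Qed.
Let mH : measurable_fun [set: Omega] H.
Proof.
case: chan => _ [_ _ [power1 power2] _ _].
have -> : H = fun w => ((H w).1, (H w).2) by apply/funext => w; case: (H w).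
exact: measurable_fun_pair.
Qed.
Let cdf1 x : 0 <= x ->
  P [set w | (H w).1 <= x] = (1 - expR (- x ^+ 2 / (2 * s1 ^+ 2)))%:E.
Proof. by case: chan => _ [_ _ _ _ /(_ x) h] /h[]. Qed.
Let cdf2 x : 0 <= x ->
  P [set w | (H w).2 <= x] = (1 - expR (- x ^+ 2 / (2 * s2 ^+ 2)))%:E.
Proof. by case: chan => _ [_ _ _ _ /(_ x) h] /h[]. Qed.

(** * Rate pairs as a finite type, and their minimal powers *)

Definition codebook : finType := ('I_(size Rs).+1 * 'I_(size Rs).+1)%type.
Definition silent : codebook := (ord0, ord0).
Definition rates (i : codebook) : R * R := (nth 0 (0 :: Rs) i.1, nth 0 (0 :: Rs) i.2).

(** A convenient upper bound for all rates; it is in general larger than their maximum. *)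
Definition max_rate : R := \sum_(j < (size Rs).+1) nth 0 (0 :: Rs) j.

Lemma nth_rate_ge0 (j : 'I_(size Rs).+1) : 0 <= nth 0 (0 :: Rs) j.
Proof.
have : nth 0 (0 :: Rs) j \in 0 :: Rs by exact: mem_nth.
by rewrite inE => /predU1P[->//|/Rs_gt0/ltW].
Qed.

Lemma nth_rate_le (j : 'I_(size Rs).+1) : nth 0 (0 :: Rs) j <= max_rate.
Proof.
by rewrite /max_rate (bigD1 j)//= lerDl sumr_ge0// => k _; exact: nth_rate_ge0.
Qed.

Lemma max_rate_ge0 : 0 <= max_rate.
Proof. by apply: sumr_ge0 => k _; exact: nth_rate_ge0. Qed.

Lemma rates_silent : rates silent = (0, 0).
Proof. by []. Qed.

Lemma rates_ok i : rate_ok Rs (rates i).1 /\ rate_ok Rs (rates i).2.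
Proof.
have ok (j : 'I_(size Rs).+1) : rate_ok Rs (nth 0 (0 :: Rs) j).
  have : nth 0 (0 :: Rs) j \in 0 :: Rs by exact: mem_nth.
  by rewrite inE => /predU1P[]; [left|right].
by split; exact: ok.
Qed.

Lemma rate_ok_rates r : rate_ok Rs r.1 -> rate_ok Rs r.2 ->
  exists i, rates i = r.
Proof.
have ok x : rate_ok Rs x -> exists j : 'I_(size Rs).+1, nth 0 (0 :: Rs) j = x.
  move=> [->|xRs]; first by exists ord0.
  have : x \in 0 :: Rs by rewrite inE xRs orbT.
  by move=> /(nthP 0)[j jlt jx]; exists (Ordinal jlt).
by case: r => a b /= /ok[j1 <-] /ok[j2 <-]; exists (j1, j2).
Qed.

Definition power1 h i := mac_power1 h (rates i).
Definition power2 h i := mac_power2 h (rates i).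

Lemma power1_ge0 h i : 0 < h.1 -> 0 < h.2 -> 0 <= power1 h i.
Proof. by move=> *; apply: mac_power1_ge0 => //=; exact: nth_rate_ge0. Qed.

Lemma power2_ge0 h i : 0 < h.1 -> 0 < h.2 -> 0 <= power2 h i.
Proof. by move=> *; apply: mac_power2_ge0 => //=; exact: nth_rate_ge0. Qed.

Lemma power1_silent h : power1 h silent = 0.
Proof. by rewrite /power1 /mac_power1 /= snr_gap0 !mul0r. Qed.

Lemma power2_silent h : power2 h silent = 0.
Proof. by rewrite /power2 /mac_power2 /= snr_gap0 !mul0r. Qed.

(** * Bounded gains and grids of nearly constant cost *)

Lemma prob_gain_nonpos :
  prob P [set w | (H w).1 <= 0] = 0 /\ prob P [set w | (H w).2 <= 0] = 0.
Proof.
by rewrite /prob cdf1// cdf2//= expr0n/= oppr0 !mul0r expR0 subrr.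
Qed.

Definition bounded_gains (n : nat) : set (R * R) :=
  [set h | n.+1%:R^-1 <= h.1 <= n.+1%:R /\ n.+1%:R^-1 <= h.2 <= n.+1%:R].

Lemma measurable_bounded_gains n : measurable (bounded_gains n).
Proof.
have mIcc (u : R * R -> R) a b : measurable_fun setT u ->
    measurable [set h | a <= u h <= b].
  move=> mu; rewrite (_ : mkset _ = [set h | u h <= b] `&` ~` [set h | u h < a]).
    apply: measurableI; first exact: measurable_le_cst.
    by apply: measurableC; exact: measurable_lt_cst.
  apply/seteqP; split => h /=.
    by move=> /andP[? ?]; split => //; rewrite ltNge; apply/negP; rewrite negbK.
  by move=> [-> /negP]; rewrite -leNgt => ->.
by apply: measurableI; apply: mIcc; [exact: measurable_fst|exact: measurable_snd].
Qed.

Lemma prob_unbounded_gains e : 0 < e ->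
  exists n, prob P (H @^-1` ~` bounded_gains n) < e.
Proof.
have mB n : measurable (H @^-1` ~` bounded_gains n).
  by apply: measurable_preimage_gain => //; apply: measurableC; exact: measurable_bounded_gains.
apply: prob_nonincreasing_small => //.
- move=> n w /= nB B; apply: nB.
  have le1 : n.+1%:R <= n.+2%:R :> R by rewrite ler_nat.
  have le2 : n.+2%:R^-1 <= n.+1%:R^-1 :> R by rewrite lef_pV2 ?posrE.
  move: B => [/andP[b1 b2] /andP[b3 b4]]; split; apply/andP; split.
  - exact: le_trans le2 b1.
  - exact: le_trans b2 le1.
  - exact: le_trans le2 b3.
  - exact: le_trans b4 le1.
have [P1 P2] := prob_gain_nonpos.
have power1 : measurable [set w | (H w).1 <= 0].
  by apply: measurable_le_cst; exact: measurableT_comp measurable_fst mH.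
have power2 : measurable [set w | (H w).2 <= 0].
  by apply: measurable_le_cst; exact: measurableT_comp measurable_snd mH.
apply/eqP; rewrite eq_le measure_ge0 andbT.
apply: (@le_trans _ _ (P ([set w | (H w).1 <= 0] `|` [set w | (H w).2 <= 0]))).
  apply: le_measure; rewrite ?inE.
  - exact: bigcapT_measurable.
  - exact: measurableU.
  move=> w Bw; apply: contrapT => /not_orP[/negP + /negP]; rewrite -!ltNge => h1 h2.
  pose n := maxn (maxn (Num.truncn (H w).1) (Num.truncn (H w).2))
    (maxn (Num.truncn (H w).1^-1) (Num.truncn (H w).2^-1)).
  have B (x : R) : (Num.truncn x <= n)%N -> x <= n.+1%:R.
    by move=> xn; apply: ltW; apply: lt_le_trans (truncnS_gt x) _; rewrite ler_nat.
  apply: (Bw n I); split; apply/andP; split.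
  - by rewrite invf_ple ?posrE//; apply: B; rewrite !leq_max leqnn !orbT.
  - by apply: B; rewrite !leq_max leqnn ?orbT.
  - by rewrite invf_ple ?posrE//; apply: B; rewrite !leq_max leqnn !orbT.
  - by apply: B; rewrite !leq_max leqnn ?orbT.
have <- : (P [set w | ((H w).1 <= 0)%R] + P [set w | ((H w).2 <= 0)%R])%E = 0%E.
  by rewrite !probE// P1 P2 adde0.
exact: measureU2.
Qed.

(* Cells on which both [h_j^-2] are known up to a factor [1 + delta], so that the
   minimal powers of all rate pairs are too. *)
Record grid (delta eps : R) (K : finType) (cell : R * R -> K) (good : pred K)
    (C1 C2 : K -> codebook -> R) : Prop := Grid {
  grid_measurable : forall k, measurable (cell @^-1` [set k]);
  grid_gain : forall h, good (cell h) -> 0 < h.1 /\ 0 < h.2;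
  grid_power1 : forall h i, good (cell h) ->
    C1 (cell h) i <= power1 h i <= (1 + delta) * C1 (cell h) i;
  grid_power2 : forall h i, good (cell h) ->
    C2 (cell h) i <= power2 h i <= (1 + delta) * C2 (cell h) i;
  grid_cost_ge0 : forall k i, 0 <= C1 k i /\ 0 <= C2 k i;
  grid_bad : forall k i, ~~ good k -> C1 k i = 0 /\ C2 k i = 0;
  grid_silent : forall k, C1 k silent = 0 /\ C2 k silent = 0;
  grid_prob : prob P [set w | ~~ good (cell (H w))] <= eps }.

(** Inverse squared gains are rounded down to multiples of [1 / M], and a cell also records which
    gain is larger, because the minimal powers depend on it. All unbounded gains form the single bad
    cell. *)
Lemma exists_grid delta eps : 0 < delta -> 0 < eps ->
  exists K cell good C1 C2, @grid delta eps K cell good C1 C2.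
Proof.
move=> delta0 eps0.
have [n Pn] := prob_unbounded_gains eps eps0.
(* On bounded gains [u] lies between [M0] and [N], so rounding down costs a factor of at most 1 +
   1/M0 <= 1 + [delta]. *)
pose M0 : nat := (Num.truncn delta^-1).+1.
pose M : nat := (M0 * n.+1 ^ 2)%N.
pose N : nat := (M * n.+1 ^ 2)%N.
pose u (x : R) : R := M%:R * (x ^+ 2)^-1.
pose lv (x : R) : 'I_N.+1 := inord (Num.truncn (u x)).
pose K : finType := option ('I_N.+1 * 'I_N.+1 * bool).
pose cell (h : R * R) : K :=
  if `[< bounded_gains n h >] then Some (lv h.1, lv h.2, h.2 <= h.1) else None.
pose C1 (k : K) i := if k is Some (a, _, b) then
  snr_gap (rates i).1 * (if b then 1 + snr_gap (rates i).2 else 1) * (a%:R / M%:R) else 0.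
pose C2 (k : K) i := if k is Some (_, a, b) then
  snr_gap (rates i).2 * (if b then 1 else 1 + snr_gap (rates i).1) * (a%:R / M%:R) else 0.
have n0 : 0 < n.+1%:R :> R by [].
have M00 : 0 < M0%:R :> R by rewrite ltr0n.
have M_gt0 : 0 < M%:R :> R by rewrite ltr0n muln_gt0 expn_gt0.
have lvP x : n.+1%:R^-1 <= x <= n.+1%:R ->
    [/\ 0 < x, (Num.truncn (u x) <= N)%N,
        (lv x)%:R / M%:R <= (x ^+ 2)^-1 &
        (x ^+ 2)^-1 <= (1 + delta) * ((lv x)%:R / M%:R)].
  move=> /andP[xl xr]; have x0 : 0 < x by apply: lt_le_trans xl; rewrite invr_gt0.
  have x2 : 0 < x ^+ 2 by rewrite exprn_gt0.
  have u0 : 0 <= u x by rewrite mulr_ge0// invr_ge0 ltW.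
  have uN : u x <= N%:R.
    rewrite /u /N natrM ler_wpM2l// natrX -[leRHS]invrK lef_pV2 ?posrE ?invr_gt0 ?exprn_gt0//.
    by rewrite -exprVn ler_pXn2r ?nnegrE ?invr_ge0// ltW.
  have uM0 : M0%:R <= u x.
    rewrite /u /M natrM natrX -mulrA ler_peMr// ler_pdivlMr// mul1r.
    by rewrite ler_pXn2r ?nnegrE// ltW.
  have tN : (Num.truncn (u x) <= N)%N.
    by rewrite truncn_le_nat; apply: le_lt_trans uN _; rewrite ltr_nat.
  have lvE : (lv x)%:R = (Num.truncn (u x))%:R :> R by rewrite /lv inordK.
  have /andP[t1 t2] := truncn_itv u0.
  split => //; rewrite lvE.
    by rewrite ler_pdivrMr// mulrC.
  rewrite mulrA ler_pdivlMr// mulrC -/(u x) (le_trans (ltW t2))//.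
  rewrite -natr1 mulrDl mul1r lerD2l.
  have M0t : M0%:R <= (Num.truncn (u x))%:R :> R.
    by rewrite ler_nat truncn_ge_nat.
  have : delta^-1 <= M0%:R by rewrite ltW// truncnS_gt.
  by rewrite -[delta^-1]mul1r ler_pdivrMr// => H1; nra.
have gap_ge0 (j : 'I_(size Rs).+1) : 0 <= snr_gap (nth 0 (0 :: Rs) j).
  by apply: snr_gap_ge0; exact: nth_rate_ge0.
exists K, cell, isSome, C1, C2; split.
- have mu (v : R * R -> R) : measurable_fun setT v -> measurable_fun setT (fun h => u (v h)).
    move=> mv; apply: measurable_funM; first exact: measurable_cst.
    exact: measurable_inv_sqr.
  have mlv (v : R * R -> R) (a : 'I_N.+1) : measurable_fun setT v ->
      measurable [set h | lv (v h) = a].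
    move=> mv.
    have -> : [set h | lv (v h) = a] =
        (fun h => u (v h)) @^-1` [set x | inord (Num.truncn x) = a] by [].
    rewrite -[X in measurable X]setTI; apply: mu => //.
    have -> : [set x : R | inord (Num.truncn x) = a] =
        \bigcup_(k in [set k | inord k = a]) [set x : R | Num.truncn x = k].
      by apply/seteqP; split => [x xa|x [k /= ka ->]//]; exists (Num.truncn x).
    apply: bigcup_measurable => k _.
    have -> : [set x : R | Num.truncn x = k] =
        [set x | (Num.truncn x <= k)%N] `\` (if k is k'.+1 then [set x | (Num.truncn x <= k')%N] else set0).
      apply/seteqP; split => x /=; case: k => [|k] /=.
      - by move=> ->; split.
      - by move=> ->; split; rewrite ?ltnn.
      - by move=> [+ _]; rewrite leqn0 => /eqP.
      - by move=> [xk /negP]; rewrite -ltnNge => kx; apply/eqP; rewrite eqn_leq xk.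
    have ml (l : nat) : measurable [set x : R | (Num.truncn x <= l)%N].
      rewrite (_ : mkset _ = [set x : R | x < l.+1%:R]).
        by apply: measurable_lt_cst; exact: measurable_id.
      by apply/seteqP; split => x /=; rewrite truncn_le_nat.
    apply: measurableD => //; case: k => //= k; exact: ml.
  move=> [[[a b] c]|]; last first.
    rewrite (_ : cell @^-1` _ = ~` bounded_gains n).
      by apply: measurableC; exact: measurable_bounded_gains.
    by apply/seteqP; split => h /=; rewrite /cell; case: asboolP.
  rewrite (_ : cell @^-1` _ = bounded_gains n `&` ([set h | lv h.1 = a] `&`
      ([set h | lv h.2 = b] `&` [set h | (h.2 <= h.1) = c]))).
    apply: measurableI; first exact: measurable_bounded_gains.
    apply: measurableI; first by apply: mlv; exact: measurable_fst.
    apply: measurableI; first by apply: mlv; exact: measurable_snd.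
    have mle : measurable [set h : R * R | h.2 - h.1 <= 0].
      apply: measurable_le_cst; apply: measurable_funB; [exact: measurable_snd|exact: measurable_fst].
    have -> : [set h : R * R | (h.2 <= h.1) = c] = if c
        then [set h : R * R | h.2 - h.1 <= 0] else ~` [set h : R * R | h.2 - h.1 <= 0].
      case: c; apply/seteqP; split => h /=; rewrite subr_le0//.
        by move=> ->.
      by move=> /negP/negbTE.
    by case: c => //; exact: measurableC.
  apply/seteqP; split => h /=; rewrite /cell; case: asboolP => //.
    by move=> Bh [<- <- <-].
  by move=> Bh [_ [-> [-> ->]]].
  by move=> nB [].
- move=> h; rewrite /cell; case: asboolP => // -[/lvP[? _ _ _] /lvP[? _ _ _]] _.
  by split.
- move=> h i; rewrite /cell; case: asboolP => // -[/lvP[? _ l1 l2] _] _ /=.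
  rewrite /power1 /mac_power1; set c := _ * (if _ then _ else _).
  have c0 : 0 <= c.
    by rewrite /c; apply: mulr_ge0 => //; case: ifP => // _; apply: addr_ge0.
  apply/andP; split; first exact: ler_wpM2l.
  by rewrite [leRHS]mulrCA; exact: ler_wpM2l.
- move=> h i; rewrite /cell; case: asboolP => // -[_ /lvP[? _ l1 l2]] _ /=.
  rewrite /power2 /mac_power2; set c := _ * (if _ then _ else _).
  have c0 : 0 <= c.
    by rewrite /c; apply: mulr_ge0 => //; case: ifP => // _; apply: addr_ge0.
  apply/andP; split; first exact: ler_wpM2l.
  by rewrite [leRHS]mulrCA; exact: ler_wpM2l.
- move=> [[[a b] c]|] i //=; split; apply: mulr_ge0 => //.
  + by apply: mulr_ge0 => //; case: ifP => // _; apply: addr_ge0.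
  + by apply: mulr_ge0 => //; case: ifP => // _; apply: addr_ge0.
- by move=> [].
- by move=> [[[a b] c]|] //=; rewrite snr_gap0 !mul0r.
- apply: le_trans (ltW Pn); rewrite le_eqVlt; apply/orP; left; apply/eqP.
  congr (prob P _); apply/seteqP; split => w /=; rewrite /cell; case: asboolP => //.
Qed.
Lemma measurable_power1 i : measurable_fun [set: R * R] (power1 ^~ i).
Proof.
apply: measurable_funM; last by apply: measurable_inv_sqr; exact: measurable_fst.
apply: measurable_funM; first exact: measurable_cst.
by apply: measurable_fun_ifT => //; apply: measurable_fun_ler.
Qed.

Lemma measurable_power2 i : measurable_fun [set: R * R] (power2 ^~ i).
Proof.
apply: measurable_funM; last by apply: measurable_inv_sqr; exact: measurable_snd.
apply: measurable_funM; first exact: measurable_cst.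
by apply: measurable_fun_ifT => //; apply: measurable_fun_ler.
Qed.

(** Transmittability is demanded for every outcome, even on the null event of a nonpositive gain;
    imposing silence there settles it at no cost. *)
Definition rate_map (f : R * R -> codebook) : Prop :=
  (forall i, measurable (f @^-1` [set i])) /\
  (forall h, f h != silent -> 0 < h.1 /\ 0 < h.2).

Definition mean_rate (rho : codebook -> R) (f : R * R -> codebook) : R :=
  \sum_i rho i * prob P [set w | f (H w) = i].

Definition feasible (f : R * R -> codebook) (a1 a2 : R) : Prop :=
  [/\ rate_map f,
      (\int[P]_w (power1 (H w) (f (H w)))%:E <= a1%:E)%E &
      (\int[P]_w (power2 (H w) (f (H w)))%:E <= a2%:E)%E].

Lemma measurable_fibre_map f i : rate_map f -> measurable ((f \o H) @^-1` [set i]).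
Proof. by move=> [mf _]; exact: measurable_preimage_gain mH _ (mf i). Qed.

Lemma integral_rate rho f : rate_map f -> (forall i, 0 <= rho i) ->
  (\int[P]_w (rho (f (H w)))%:E = (mean_rate rho f)%:E)%E.
Proof.
move=> mf rho0; apply: (integral_fibres P (f \o H)) => // i.
exact: measurable_fibre_map.
Qed.

Lemma measurable_rate_map d' (X : measurableType d') (G : R * R -> codebook -> X) f :
  rate_map f -> (forall i, measurable_fun setT (G ^~ i)) ->
  measurable_fun setT (fun w => G (H w) (f (H w))).
Proof.
move=> mf mG.
apply: (measurable_fun_fibres (f \o H) _ _ _ (fun i w => G (H w) i)) => i.
  exact: measurable_fibre_map.
exact: measurableT_comp (mG i) mH.
Qed.

Lemma power1_map_ge0 f h : rate_map f -> 0 <= power1 h (f h).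
Proof.
move=> [_ fpos]; have [->|/fpos[]] := eqVneq (f h) silent; first by rewrite power1_silent.
exact: power1_ge0.
Qed.

Lemma power2_map_ge0 f h : rate_map f -> 0 <= power2 h (f h).
Proof.
move=> [_ fpos]; have [->|/fpos[]] := eqVneq (f h) silent; first by rewrite power2_silent.
exact: power2_ge0.
Qed.

(** Only the fraction [theta] of each weight is realized and the rest of the cell is silent, which
    scales powers and rates alike. The factor [1 + delta] is the rounding of the grid; the rate lost
    is the one recorded on bad cells. *)
Lemma feasible_of_weights delta eps (K : finType) cell good C1 C2
    (w : K -> codebook -> R) theta :
  @grid delta eps K cell good C1 C2 -> 0 < delta -> 0 <= theta <= 1 ->
  (forall k i, 0 <= w k i) ->
  (forall k, \sum_i w k i = prob P (H @^-1` (cell @^-1` [set k]))) ->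
  exists2 f, feasible f ((1 + delta) * theta * \sum_k \sum_i w k i * C1 k i)
                        ((1 + delta) * theta * \sum_k \sum_i w k i * C2 k i) &
    forall rho, (forall i, 0 <= rho i <= max_rate) -> rho silent = 0 ->
      theta * (\sum_k \sum_i w k i * rho i - max_rate * eps) <= mean_rate rho f.
Proof.
move=> [mcell gpos gp1 gp2 C0 Cbad Csil Pbad] delta0 /andP[t0 t1] w0 wE.
have [k i||f [mf fbad fw]] := realize_weights P H s1 mH cdf1 K codebook cell good silent
  (fun k i => theta * w k i) mcell.
- exact: mulr_ge0.
- by move=> k; rewrite -mulr_sumr -wE ler_piMl// sumr_ge0.
have mapf : rate_map f.
  split=> // h fh; apply: gpos; apply: contraNT fh => /fbad ->; exact: eqxx.
pose jf v := (cell (H v), f (H v)).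
have mjf s : measurable (jf @^-1` [set s]).
  rewrite (_ : _ @^-1` _ = H @^-1` (cell @^-1` [set s.1] `&` f @^-1` [set s.2])).
    by apply: measurable_preimage_gain => //; exact: measurableI.
  by apply/seteqP; split => v; rewrite /jf /=; case: s => a b /= [-> ->].
have pE k i : good k -> i != silent -> prob P (jf @^-1` [set (k, i)]) = theta * w k i.
  move=> gk ik; rewrite -fw//; congr (prob P _).
  by apply/seteqP; split => v; rewrite /jf /= => -[-> ->].
have power (C : K -> codebook -> R) (m : R * R -> codebook -> R) :
    (forall h i, good (cell h) -> C (cell h) i <= m h i <= (1 + delta) * C (cell h) i) ->
    (forall k i, 0 <= C k i) -> (forall k i, ~~ good k -> C k i = 0) ->
    (forall k, C k silent = 0) -> (forall h, m h silent = 0) ->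
    (forall i, measurable_fun setT (m ^~ i)) ->
    (forall h, 0 <= m h (f h)) ->
    (\int[P]_v (m (H v) (f (H v)))%:E <=
      ((1 + delta) * theta * \sum_k \sum_i w k i * C k i)%:E)%E.
  move=> mC {}C0 {}Cbad {}Csil msil mm m0.
  have d1 : 0 <= 1 + delta by lra.
  apply: (@le_trans _ _ (\int[P]_v ((1 + delta) * C (jf v).1 (jf v).2)%:E)%E).
    apply: integral_EFin_le => //.
    - exact: (measurable_rate_map _ _ m).
    - exact: (measurable_fun_fibres jf mjf _ _ (fun s _ => (1 + delta) * C s.1 s.2)).
    - move=> v; rewrite /jf /=; have [g|/fbad ->] := boolP (good (cell (H v))).
        by have /andP[] := mC (H v) (f (H v)) g.
      by rewrite msil Csil mulr0.
  rewrite (integral_fibres P jf mjf (fun s => (1 + delta) * C s.1 s.2)); last first.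
    by move=> s; rewrite mulr_ge0.
  rewrite lee_fin pair_bigA/= mulr_sumr; apply: ler_sum => -[k i] _ /=.
  have [g|/Cbad->] := boolP (good k); last by rewrite !(mulr0, mul0r).
  have [->|ik] := eqVneq i silent; first by rewrite Csil !(mulr0, mul0r).
  by rewrite pE// -!mulrA ler_wpM2l// [C k i * _]mulrC -mulrA.
exists f.
  split => //; apply: power => //.
  - by move=> k i; have [] := C0 k i.
  - by move=> k i /(Cbad k i)[].
  - by move=> k; have [] := Csil k.
  - exact: power1_silent.
  - exact: measurable_power1.
  - by move=> h; exact: power1_map_ge0.
  - by move=> k i; have [] := C0 k i.
  - by move=> k i /(Cbad k i)[].
  - by move=> k; have [] := Csil k.
  - exact: power2_silent.
  - exact: measurable_power2.
  - by move=> h; exact: power2_map_ge0.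
move=> rho rhoB rho_silent.
have rho0 i : 0 <= rho i by have /andP[] := rhoB i.
rewrite -lee_fin -integral_rate//.
rewrite (integral_fibres P jf mjf (fun s => rho s.2))// lee_fin.
have bad_le : \sum_(k | ~~ good k) \sum_i w k i * rho i <= max_rate * eps.
  apply: (@le_trans _ _ (\sum_(k | ~~ good k) max_rate *
      prob P ((cell \o H) @^-1` [set k]))).
    apply: ler_sum => k _; rewrite -[prob _ _]wE mulr_sumr; apply: ler_sum => i _.
    by rewrite mulrC ler_wpM2r//; have /andP[] := rhoB i.
  rewrite -mulr_sumr -(prob_fibres P (cell \o H) _ (fun k => ~~ good k)).
    by rewrite ler_wpM2l// max_rate_ge0.
  by move=> k; exact: (measurable_preimage_gain H mH _ (mcell k)).
apply: (@le_trans _ _ (\sum_(k | good k) \sum_i theta * w k i * rho i)).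
  rewrite (bigID good)/= -[X in _ <= X]mulr1.
  have -> : \sum_(k | good k) \sum_i theta * w k i * rho i =
      theta * \sum_(k | good k) \sum_i w k i * rho i.
    rewrite mulr_sumr; apply: eq_bigr => k _; rewrite mulr_sumr.
    by apply: eq_bigr => i _; rewrite mulrA.
  by rewrite mulr1 ler_wpM2l//; lra.
have -> : \sum_s rho s.2 * prob P (jf @^-1` [set s]) =
    \sum_k \sum_i rho i * prob P (jf @^-1` [set (k, i)]).
  by rewrite pair_bigA/=; apply: eq_bigr => -[].
rewrite [leRHS](bigID good)/= -[leLHS]addr0; apply: lerD; last first.
  by do 2!apply: sumr_ge0 => ? _; rewrite mulr_ge0// prob_ge0.
apply: ler_sum => k gk; apply: ler_sum => i _.
have [->|ik] := eqVneq i silent; first by rewrite rho_silent mulr0 mul0r.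
by rewrite pE// mulrC.
Qed.

(** * From arbitrary policies to stationary rate maps *)

Lemma closure_approx (A : set (R * R)) x : closure A x -> forall e, 0 < e ->
  exists y, [/\ A y, `|x.1 - y.1| < e & `|x.2 - y.2| < e].
Proof.
move=> /(_ _ (nbhsx_ballx _ _ _)) Ax e e0.
by have [y [Ay [? ?]]] := Ax e e0; exists y.
Qed.

(** The common description of both regions, with [a] the budget of the first MAC user. Quantifying
    [theta] after [a] lets the thinning be chosen later, so as to make the power constraints exact
    for a fixed split. *)
Definition reachable (lam : R * R) : Prop :=
  0 <= lam.1 /\ 0 <= lam.2 /\ forall delta, 0 < delta ->
    exists2 a, 0 <= a <= Pt & forall theta, 0 <= theta <= 1 ->
      exists f, [/\
        feasible f ((1 + delta) * theta * a) ((1 + delta) * theta * (Pt - a)),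
        theta * (lam.1 - delta) <= mean_rate (fst \o rates) f &
        theta * (lam.2 - delta) <= mean_rate (snd \o rates) f].

Lemma closure_supported_reachable (trans : R * R -> R * R -> R * R -> Prop)
    (powc : policy -> Prop) lam :
  (forall h r p, trans h r p -> 0 <= p.1 /\ 0 <= p.2) ->
  (forall h i p, 0 < h.1 -> 0 < h.2 -> trans h (rates i) p ->
     power1 h i + power2 h i <= p.1 + p.2) ->
  (forall pi : policy, powc pi ->
     (forall t w, 0 <= (pi t (traj T H w)).2.1 /\ 0 <= (pi t (traj T H w)).2.2) ->
     (forall t, measurable_fun [set: Omega] (fun w => (pi t (traj T H w)).2.1) /\
                measurable_fun [set: Omega] (fun w => (pi t (traj T H w)).2.2)) ->
     forall t, (\int[P]_w ((pi t (traj T H w)).2.1 + (pi t (traj T H w)).2.2)%:E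
        <= Pt%:E)%E) ->
  closure (supported P T H Rs trans powc) lam -> reachable lam.
Proof.
move=> trans_ge0 trans_power powcP cl.
have lam0 : 0 <= lam.1 /\ 0 <= lam.2.
  have pos x : (forall e : R, 0 < e -> - e < x) -> 0 <= x.
    move=> xe; rewrite leNgt; apply/negP => x0.
    by have := xe (- x / 2); rewrite divr_gt0 ?oppr_gt0// => /(_ isT); lra.
  split; apply: pos => e e0;
    have [y [[y1 [y2 _]]]] := closure_approx _ _ cl _ e0;
    rewrite !ltr_norml => /andP[? ?] /andP[? ?]; lra.
have [lam10 lam20] := lam0; split => //; split => // delta delta0.
(* Three losses of at most [e] occur: replacing [lam] by a supported vector, averaging, and
   silencing the bad cells. *)
pose e := delta / 4; have e0 : 0 < e by rewrite divr_gt0.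
pose eps := e / (max_rate + 1).
have Rm0 := max_rate_ge0.
have eps0 : 0 < eps by rewrite divr_gt0//; lra.
have [l [[l10 [l20 [pi [_ mpow pw tr ae]]]] d1 d2]] := closure_approx _ _ cl _ e0.
have [K [cell [good [C1 [C2 G]]]]] := exists_grid delta eps delta0 eps0.
have pow0 t w : 0 <= (pi t (traj T H w)).2.1 /\ 0 <= (pi t (traj T H w)).2.2.
  by have [_ [_ /trans_ge0]] := tr t w.
have /choice[r Hr] : forall tw : nat * Omega, exists i,
    rates i = (pi tw.1 (traj T H tw.2)).1.
  by move=> [t w]; have [? [? _]] := tr t w; exact: rate_ok_rates.
have [mcell gpos gp1 gp2 C0 Cbad Csil Pbad] := G.
have [w [w0 wE wC w1 w2]] : exists w : K -> codebook -> R,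
    [/\ forall k i, 0 <= w k i,
        forall k, \sum_i w k i = prob P (H @^-1` (cell @^-1` [set k])),
        \sum_k \sum_i w k i * (C1 k i + C2 k i) <= Pt,
        l.1 - e <= \sum_k \sum_i w k i * (rates i).1 &
        l.2 - e <= \sum_k \sum_i w k i * (rates i).2].
  apply: (averaged_weights P T H mT PT mH K codebook cell silent
    (fun k i => C1 k i + C2 k i) mcell _ _ (fun i => (rates i).1) (fun i => (rates i).2)
    (fun t w => (pi t (traj T H w)).2.1 + (pi t (traj T H w)).2.2) Pt _ _ _ _ _
    (fun t w => r (t, w))) => //.
  - by move=> k i; have [? ?] := C0 k i; exact: addr_ge0.
  - by move=> k; have [-> ->] := Csil k; rewrite addr0.
  - by move=> i; exact: nth_rate_ge0.
  - by move=> i; exact: nth_rate_ge0.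
  - by move=> t; have [? ?] := mpow t; exact: measurable_funD.
  - by move=> t w; have [? ?] := pow0 t w; exact: addr_ge0.
  - by move=> t; exact: powcP.
  - move=> t w; have [? ?] := pow0 t w.
    have [g|/(Cbad _ (r (t, w)))[-> ->]] := boolP (good (cell (H (iter t T w)))); last first.
      by rewrite addr0 addr_ge0.
    have [h1 h2] := gpos _ g.
    have /andP[c1 _] := gp1 _ (r (t, w)) g.
    have /andP[c2 _] := gp2 _ (r (t, w)) g.
    apply: le_trans (lerD c1 c2) _; apply: trans_power => //.
    by rewrite (Hr (t, w)) /=; have [_ [_]] := tr t w.
  - apply: filterS ae => w Hw e' e'0; have [N HN] := Hw e' e'0.
    exists N => n nN; have [H1 H2] := HN n nN; split.
    + by under eq_bigr do rewrite (Hr (_, w)).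
    + by under eq_bigr do rewrite (Hr (_, w)).
pose a := \sum_k \sum_i w k i * C1 k i.
pose b := \sum_k \sum_i w k i * C2 k i.
have a0 : 0 <= a.
  apply: sumr_ge0 => k _; apply: sumr_ge0 => i _; rewrite mulr_ge0//.
  by have [] := C0 k i.
have b0 : 0 <= b.
  apply: sumr_ge0 => k _; apply: sumr_ge0 => i _; rewrite mulr_ge0//.
  by have [] := C0 k i.
have ab : a + b <= Pt.
  apply: le_trans wC; rewrite /a /b -big_split/= le_eqVlt; apply/orP; left; apply/eqP.
  apply: eq_bigr => k _; rewrite -big_split/=.
  by apply: eq_bigr => i _; rewrite mulrDr.
exists a; first by rewrite a0/=; lra.
move=> theta theta01; have /andP[t0 t1] := theta01.
have [f [mapf fa fb] frate] := feasible_of_weights delta eps K cell good C1 C2 w theta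
  G delta0 theta01 w0 wE.
have Rme : max_rate * eps <= e.
  rewrite /eps mulrCA; apply: ler_piMr; first exact: ltW.
  by rewrite ler_pdivrMr; lra.
have de : delta = e *+ 4 by rewrite /e; lra.
exists f; split.
- split => //; apply: le_trans fb _; rewrite lee_fin ler_wpM2l//; last first.
    by rewrite -/b; lra.
  by rewrite mulr_ge0//; lra.
- apply: le_trans (frate _ _ _) => //.
    rewrite ler_wpM2l//; move: d1; rewrite ltr_norml => /andP[? ?]; move: w1 => /=; lra.
  by move=> i /=; rewrite nth_rate_ge0 nth_rate_le.
- apply: le_trans (frate _ _ _) => //.
    rewrite ler_wpM2l//; move: d2; rewrite ltr_norml => /andP[? ?]; move: w2 => /=; lra.
  by move=> i /=; rewrite nth_rate_ge0 nth_rate_le.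
Qed.

(** * From stationary rate maps back to policies *)

Lemma stationary_supported (trans : R * R -> R * R -> R * R -> Prop)
    (powc : policy -> Prop) (pw : R * R -> codebook -> R * R) f lam :
  rate_map f ->
  (forall i, measurable_fun setT (fun h => (pw h i).1)) ->
  (forall i, measurable_fun setT (fun h => (pw h i).2)) ->
  (forall h, trans h (rates (f h)) (pw h (f h))) ->
  powc (fun t g => (rates (f (g t)), pw (g t) (f (g t)))) ->
  0 <= lam.1 -> 0 <= lam.2 ->
  (lam.1 = 0 \/ lam.1 < mean_rate (fst \o rates) f) ->
  (lam.2 = 0 \/ lam.2 < mean_rate (snd \o rates) f) ->
  supported P T H Rs trans powc lam.
Proof.
move=> mapf mpw1 mpw2 transf powcf lam1 lam2 lt1 lt2; split => //; split => //.
exists (fun t g => (rates (f (g t)), pw (g t) (f (g t)))); split => //.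
- by move=> t g g' gg; rewrite gg.
- move=> t; split.
  + exact: measurableT_comp (measurable_rate_map _ _ (fun h i => (pw h i).1) f mapf mpw1)
      (measurable_iter T mT t).
  + exact: measurableT_comp (measurable_rate_map _ _ (fun h i => (pw h i).2) f mapf mpw2)
      (measurable_iter T mT t).
- by move=> t w; have [? ?] := rates_ok (f (traj T H w t)).
have ae rho l : (forall i, 0 <= rho i <= max_rate) -> l = 0 \/ l < mean_rate rho f ->
    {ae P, forall w, forall e : R, 0 < e -> exists N : nat, forall n, (N <= n)%N ->
      l - e <= n%:R^-1 * \sum_(t < n) rho (f (H (iter t T w)))}.
  move=> rhoB [->|lm].
    apply: aeW => w e e0; exists 0%N => n _; apply: (@le_trans _ _ 0); first by lra.
    rewrite mulr_ge0 ?invr_ge0 ?ler0n//; apply: sumr_ge0 => t _.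
    by have /andP[] := rhoB (f (H (iter t T w))).
  apply: (birkhoff_lower P T mT PT ergT (fun w => rho (f (H w))) max_rate).
  - by apply: (measurable_rate_map _ _ (fun _ i => rho i)) => // i; exact: measurable_cst.
  - by move=> w; have /andP[] := rhoB (f (H w)).
  - by move=> w; have /andP[] := rhoB (f (H w)).
  - have rho0 i : 0 <= rho i by have /andP[] := rhoB i.
    by have := integral_rate rho f mapf rho0; rewrite /= => ->; rewrite lte_fin.
have B1 i : 0 <= (fst \o rates) i <= max_rate by rewrite /= nth_rate_ge0 nth_rate_le.
have B2 i : 0 <= (snd \o rates) i <= max_rate by rewrite /= nth_rate_ge0 nth_rate_le.
apply: filterS2 (ae _ _ B1 lt1) (ae _ _ B2 lt2) => w H1 H2 e e0.
have [N1 HN1] := H1 e e0; have [N2 HN2] := H2 e e0.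
exists (maxn N1 N2) => n; rewrite geq_max => /andP[/HN1 ? /HN2 ?].
by split.
Qed.

Lemma integral_slot (g : R * R -> R) t :
  measurable_fun setT (fun w => g (H w)) -> (forall h, 0 <= g h) ->
  (\int[P]_w (g (traj T H w t))%:E = \int[P]_w (g (H w))%:E)%E.
Proof.
by move=> mg g0; exact: (ge0_integral_iter P T mT PT t (fun w => g (H w))).
Qed.

Lemma closure_intro (A : set (R * R)) x :
  (forall e, 0 < e -> exists y, [/\ A y, `|x.1 - y.1| < e & `|x.2 - y.2| < e]) ->
  closure A x.
Proof.
move=> Ax B /nbhs_ballP[e /= e0 BB]; have [y [Ay y1 y2]] := Ax e e0.
by exists y; split => //; apply: BB; split.
Qed.

(** Reduces the goal to demands that are 0 or strictly smaller, as [stationary_supported]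
    requires. *)
Lemma closure_shrink (A : set (R * R)) x : 0 <= x.1 -> 0 <= x.2 ->
  (forall e, 0 < e -> A (Num.max (x.1 - e) 0, Num.max (x.2 - e) 0)) -> closure A x.
Proof.
move=> x1 x2 Ax; apply: closure_intro => e e0.
exists (Num.max (x.1 - e / 2) 0, Num.max (x.2 - e / 2) 0); split => /=.
- by apply: Ax; rewrite divr_gt0.
- by rewrite ger0_norm; case: (leP (x.1 - e / 2) 0) => ?; lra.
- by rewrite ger0_norm; case: (leP (x.2 - e / 2) 0) => ?; lra.
Qed.

Lemma max_lt_or (l e m : R) : l - e < m -> Num.max (l - e) 0 = 0 \/ Num.max (l - e) 0 < m.
Proof. by move=> lm; case: (leP (l - e) 0) => ?; [left|right]. Qed.

Lemma bc_power_silent h : bc_power h (rates silent) = (0, 0).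
Proof. by rewrite /bc_power /= snr_gap0 !mul0r. Qed.

Lemma silent_or_positive f h : rate_map f -> f h = silent \/ (0 < h.1 /\ 0 < h.2).
Proof.
by move=> [_ fpos]; have [->|/fpos] := eqVneq (f h) silent; [left|right].
Qed.

(** The rate map is kept and its powers are replaced by [bc_power], whose sum is the same in every
    state; the split [a] disappears in the sum. *)
Lemma supported_BC f a lam :
  feasible f a (Pt - a) -> 0 <= lam.1 -> 0 <= lam.2 ->
  (lam.1 = 0 \/ lam.1 < mean_rate (fst \o rates) f) ->
  (lam.2 = 0 \/ lam.2 < mean_rate (snd \o rates) f) ->
  supported P T H Rs BC_transmittable
    (fun pi => forall t, (\int[P]_w ((pi t (traj T H w)).2.1
                                    + (pi t (traj T H w)).2.2)%:E <= Pt%:E)%E) lam.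
Proof.
move=> [mapf f1 f2].
have sumE h : (bc_power h (rates (f h))).1 + (bc_power h (rates (f h))).2 =
    power1 h (f h) + power2 h (f h).
  have [->|[h1 h2]] := silent_or_positive f h mapf; last exact: bc_power_sum.
  by rewrite power1_silent power2_silent bc_power_silent.
have mm1 := measurable_rate_map _ _ power1 f mapf measurable_power1.
have mm2 := measurable_rate_map _ _ power2 f mapf measurable_power2.
have miH1 : measurable_fun setT (fun h : R * R => (h.1 ^+ 2)^-1).
  by apply: measurable_inv_sqr; exact: measurable_fst.
have miH2 : measurable_fun setT (fun h : R * R => (h.2 ^+ 2)^-1).
  by apply: measurable_inv_sqr; exact: measurable_snd.
apply: (stationary_supported _ _ (fun h i => bc_power h (rates i))) => //.
- move=> i; apply: measurable_funM => //.
  apply: measurable_funM; first exact: measurable_cst.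
  apply: measurable_fun_ifT => //; first by apply: measurable_fun_ler.
  apply: measurable_funD; first exact: measurable_cst.
  apply: measurable_funM; first by apply: measurable_funX; exact: measurable_fst.
  by apply: measurable_funM => //; exact: measurable_cst.
- move=> i; apply: measurable_funM => //.
  apply: measurable_funM; first exact: measurable_cst.
  apply: measurable_fun_ifT => //; first by apply: measurable_fun_ler.
  apply: measurable_funD; first exact: measurable_cst.
  apply: measurable_funM; first by apply: measurable_funX; exact: measurable_snd.
  by apply: measurable_funM => //; exact: measurable_cst.
- move=> h; have [->|[h1 h2]] := silent_or_positive f h mapf; last first.
    by apply: BC_transmittable_bc_power => //; exact: nth_rate_ge0.
  rewrite bc_power_silent rates_silent; split=> //; split=> //=.
  by case: ifP => _; rewrite !(mulr0, mul0r) le_log2// snr_gap0.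
- move=> t /=; under eq_integral do rewrite sumE EFinD.
  rewrite ge0_integralD//; last first.
  + apply/measurable_EFinP.
    exact: (measurableT_comp mm2 (measurable_iter T mT t)).
  + by move=> w _; rewrite lee_fin power2_map_ge0.
  + apply/measurable_EFinP.
    exact: (measurableT_comp mm1 (measurable_iter T mT t)).
  + by move=> w _; rewrite lee_fin power1_map_ge0.
  have <- : (a%:E + (Pt - a)%:E = Pt%:E)%E by rewrite -EFinD addrC subrK.
  apply: leeD.
  + rewrite (integral_slot (fun h => power1 h (f h)))//.
    by move=> h; exact: power1_map_ge0.
  + rewrite (integral_slot (fun h => power2 h (f h)))//.
    by move=> h; exact: power2_map_ge0.
Qed.

Lemma supported_MAC f a b lam :
  feasible f a b -> 0 <= lam.1 -> 0 <= lam.2 ->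
  (lam.1 = 0 \/ lam.1 < mean_rate (fst \o rates) f) ->
  (lam.2 = 0 \/ lam.2 < mean_rate (snd \o rates) f) ->
  supported P T H Rs MAC_transmittable
    (fun pi => forall t,
       (\int[P]_w ((pi t (traj T H w)).2.1)%:E <= a%:E)%E /\
       (\int[P]_w ((pi t (traj T H w)).2.2)%:E <= b%:E)%E) lam.
Proof.
move=> [mapf f1 f2].
apply: (stationary_supported _ _ (fun h i => (power1 h i, power2 h i))) => //.
- exact: measurable_power1.
- exact: measurable_power2.
- move=> h; have [->|[h1 h2]] := silent_or_positive f h mapf; last first.
    by apply: MAC_transmittable_mac_power => //; exact: nth_rate_ge0.
  rewrite power1_silent power2_silent rates_silent; split=> //; split=> //=; left.
  by rewrite !(mulr0, mul0r) le_log2// snr_gap0.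
- move=> t /=; split.
  + rewrite (integral_slot (fun h => power1 h (f h)))//.
      exact: (measurable_rate_map _ _ power1 f mapf measurable_power1).
    by move=> h; exact: power1_map_ge0.
  + rewrite (integral_slot (fun h => power2 h (f h)))//.
      exact: (measurable_rate_map _ _ power2 f mapf measurable_power2).
    by move=> h; exact: power2_map_ge0.
Qed.

(** Thinning by [(1 + delta)^-1] cancels the excess power exactly; [delta] is so small that this
    factor and the shift by [delta] together cost less than [e] in rate. *)
Lemma reachable_BC lam : reachable lam ->
  closure (supported P T H Rs BC_transmittable
    (fun pi => forall t, (\int[P]_w ((pi t (traj T H w)).2.1
                                    + (pi t (traj T H w)).2.2)%:E <= Pt%:E)%E)) lam.
Proof.
move=> [lam1 [lam2 reach]]; apply: closure_shrink => // e e0.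
pose delta := e / (2 * (1 + lam.1 + lam.2 + e)).
have den0 : 0 < 2 * (1 + lam.1 + lam.2 + e) by lra.
have delta0 : 0 < delta by rewrite divr_gt0.
have deltaE : delta * (2 * (1 + lam.1 + lam.2 + e)) = e by rewrite divfK// gt_eqF.
have delta1 : delta <= 1 / 2 by rewrite ler_pdivrMr//; lra.
have [a a01 Ha] := reach delta delta0.
have d1 : 0 < 1 + delta by lra.
have [|f [F r1 r2]] := Ha (1 + delta)^-1.
  by rewrite invr_ge0 ltW//= invf_le1//; lra.
move: F; rewrite divff ?gt_eqF// !mul1r => F.
have lt l m : 0 <= l -> l <= lam.1 + lam.2 -> (1 + delta)^-1 * (l - delta) <= m -> l - e < m.
  move=> l0 ll; apply: lt_le_trans; rewrite mulrC ltr_pdivlMr//; nra.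
apply: (supported_BC f a) => //=.
- by rewrite le_max lexx orbT.
- by rewrite le_max lexx orbT.
- by apply: max_lt_or; apply: lt r1; lra.
- by apply: max_lt_or; apply: lt r2; lra.
Qed.

(** * Vanishing power forces vanishing rate *)

Lemma snr_gap_ge r : r <= snr_gap r / ln 2 :> R.
Proof.
rewrite ler_pdivlMr ?ln2_gt0//.
by have := expR_ge1Dx (r * ln 2 : R); rewrite /snr_gap; lra.
Qed.

(** On bounded gains the rate is at most a constant times the power; all other gains contribute at
    most [max_rate] times a small probability. *)
Lemma low_power_low_rate (rho : codebook -> R) (m : R * R -> codebook -> R)
    (gain : R * R -> R) l :
  (forall i, 0 <= rho i <= max_rate) -> rho silent = 0 ->
  (forall h, 0 < h.1 -> 0 < h.2 -> 0 < gain h) ->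
  (forall n h, bounded_gains n h -> gain h <= n.+1%:R) ->
  (forall h i, 0 < h.1 -> 0 < h.2 -> rho i <= gain h ^+ 2 * m h i / ln 2) ->
  (forall h f, rate_map f -> 0 <= m h (f h)) ->
  (forall i, measurable_fun setT (m ^~ i)) ->
  (forall tau, 0 < tau -> exists f, [/\ rate_map f,
     (\int[P]_w (m (H w) (f (H w)))%:E <= tau%:E)%E & l - tau <= mean_rate rho f]) ->
  l <= 0.
Proof.
move=> rhoB rho_silent gain0 gainB rho_m m0 mm small.
have Rm0 := max_rate_ge0; have l2 := @ln2_gt0 R.
rewrite leNgt; apply/negP => l0.
have [|n Pn] := prob_unbounded_gains (l / (4 * (max_rate + 1))).
  by rewrite divr_gt0//; lra.
pose B := ~` bounded_gains n.
have mB : measurable (H @^-1` B).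
  by apply: measurable_preimage_gain => //; apply: measurableC; exact: measurable_bounded_gains.
pose k : R := n.+1%:R ^+ 2 / ln 2.
have k0 : 0 < k by rewrite divr_gt0// exprn_gt0.
(* Each of [tau], [k * tau] and the part from unbounded gains is then at most [l / 4], which
   contradicts [0 < l]. *)
pose tau := l / (4 * (k + 1)).
have tau0 : 0 < tau by rewrite divr_gt0//; lra.
have tauE : tau * (4 * (k + 1)) = l by rewrite divfK// gt_eqF//; lra.
have [f [mapf fm fl]] := small tau tau0.
have bound : mean_rate rho f <= k * tau + max_rate * prob P (H @^-1` B).
  have mmf := measurable_rate_map _ _ m f mapf mm.
  have mind : measurable_fun setT (\1_(H @^-1` B) : Omega -> R) by exact: measurable_indic.
  have mkm : measurable_fun setT (fun w => k * m (H w) (f (H w))).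
    by apply: measurable_funM => //; exact: measurable_cst.
  have mRB : measurable_fun setT (fun w => max_rate * \1_(H @^-1` B) w : R).
    by apply: measurable_funM => //; exact: measurable_cst.
  have rho0 i : 0 <= rho i by have /andP[] := rhoB i.
  have i0 v : 0 <= (\1_(H @^-1` B) v : R) by rewrite indicE.
  rewrite -lee_fin -(integral_rate rho f mapf rho0).
  apply: (@le_trans _ _ (\int[P]_w (k * m (H w) (f (H w)) +
      max_rate * \1_(H @^-1` B) w)%:E)%E).
    apply: integral_EFin_le => //.
    - by apply: (measurable_rate_map _ _ (fun _ i => rho i)) => // i; exact: measurable_cst.
    - exact: measurable_funD.
    - move=> w; have m0w := m0 (H w) f mapf.
      have km0 : 0 <= k * m (H w) (f (H w)) by apply: mulr_ge0 => //; exact: ltW.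
      have [fw|[h1 h2]] := silent_or_positive f (H w) mapf.
        apply: (@le_trans _ _ 0); first by rewrite fw rho_silent.
        by apply: addr_ge0 => //; exact: mulr_ge0.
      have [Bw|nBw] := pselect (bounded_gains n (H w)).
        apply: (@le_trans _ _ (k * m (H w) (f (H w)))); last first.
          by rewrite lerDl mulr_ge0.
        apply: le_trans (rho_m _ _ h1 h2) _.
        rewrite /k mulrAC; apply: ler_wpM2r => //; apply: ler_wpM2r.
          by rewrite invr_ge0 ltW.
        have g0 := gain0 _ h1 h2; have gB := gainB _ _ Bw.
        by rewrite ler_pXn2r ?nnegrE// ltW.
      rewrite indicE mem_set ?mulr1//.
      by have /andP[_ rB] := rhoB (f (H w)); apply: le_trans rB _; rewrite lerDr.
  under eq_integral do rewrite EFinD.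
  rewrite ge0_integralD//; last first.
  - exact/measurable_EFinP.
  - by move=> w _; rewrite lee_fin mulr_ge0.
  - exact/measurable_EFinP.
  - by move=> w _; rewrite lee_fin; apply: mulr_ge0; [exact: ltW|exact: m0].
  rewrite EFinD; apply: leeD.
  - under eq_integral do rewrite EFinM.
    rewrite ge0_integralZl_EFin//.
    + by rewrite [leRHS]EFinM; apply: lee_wpmul2l fm; rewrite lee_fin ltW.
    + by move=> w _; rewrite lee_fin; exact: m0.
    + exact/measurable_EFinP.
    + exact: ltW.
  - under eq_integral do rewrite EFinM.
    rewrite ge0_integralZl_EFin//; last exact/measurable_EFinP.
    rewrite integral_indic// setIT [leRHS]EFinM.
    by have -> : (prob P (H @^-1` B))%:E = P (H @^-1` B) by rewrite probE.
have RP : max_rate * prob P (H @^-1` B) <= l / 4.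
  have PnE : l / (4 * (max_rate + 1)) * (4 * (max_rate + 1)) = l.
    by rewrite divfK// gt_eqF//; lra.
  apply: le_trans (ler_wpM2l Rm0 (ltW Pn)) _; move: PnE.
  have : 0 < l / (4 * (max_rate + 1)) by rewrite divr_gt0//; lra.
  by move: (l / (4 * (max_rate + 1))) => x; lra.
have : tau <= l / 4 by rewrite ler_pdivlMr//; nra.
have : k * tau <= l / 4 by rewrite ler_pdivlMr//; nra.
lra.
Qed.

(** * Silencing users and fixing the MAC power split *)

Definition drop (b1 b2 : bool) (i : codebook) : codebook :=
  (if b1 then ord0 else i.1, if b2 then ord0 else i.2).

(** A minimal power depends on the other user's rate only through an interference factor increasing
    in that rate, so silencing one user never raises the power of the other. *)
Lemma feasible_drop b1 b2 f a1 a2 : feasible f a1 a2 -> feasible (drop b1 b2 \o f)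
  (if b1 then 0 else a1) (if b2 then 0 else a2).
Proof.
move=> [mapf f1 f2].
have mapd : rate_map (drop b1 b2 \o f).
  split=> [i|h]; last first.
    move=> /= dh; apply: mapf.2; apply: contraNneq dh => ->.
    by rewrite /drop; case: b1; case: b2.
  exact: (measurable_fibres f mapf.1 (drop b1 b2 @^-1` [set i])).
have gap_ge0 (j : 'I_(size Rs).+1) : 0 <= snr_gap (nth 0 (0 :: Rs) j).
  by apply: snr_gap_ge0; exact: nth_rate_ge0.
split=> //.
- case: b1 mapd => mapd.
    rewrite (_ : (fun w => _) = cst 0%E); last first.
      by apply/funext => w; rewrite /power1 /mac_power1 /= snr_gap0 !mul0r.
    by rewrite integral0.
  apply: le_trans f1; apply: integral_EFin_le.
  + exact: (measurable_rate_map _ _ power1 _ mapd measurable_power1).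
  + exact: (measurable_rate_map _ _ power1 _ mapf measurable_power1).
  + by move=> w; exact: power1_map_ge0.
  + move=> w; have [fw|[h1 h2]] := silent_or_positive f (H w) mapf.
      by rewrite /= fw /drop; case: b2 {mapd} => /=; rewrite !power1_silent.
    rewrite /power1 /mac_power1 /=; apply: ler_wpM2r; first by rewrite invr_ge0 exprn_ge0// ltW.
    apply: ler_wpM2l => //; case: ifP => // _; case: b2 {mapd} => //=.
    by rewrite snr_gap0 lerD2l.
- case: b2 mapd => mapd.
    rewrite (_ : (fun w => _) = cst 0%E); last first.
      by apply/funext => w; rewrite /power2 /mac_power2 /= snr_gap0 !mul0r.
    by rewrite integral0.
  apply: le_trans f2; apply: integral_EFin_le.
  + exact: (measurable_rate_map _ _ power2 _ mapd measurable_power2).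
  + exact: (measurable_rate_map _ _ power2 _ mapf measurable_power2).
  + by move=> w; exact: power2_map_ge0.
  + move=> w; have [fw|[h1 h2]] := silent_or_positive f (H w) mapf.
      by rewrite /= fw /drop; case: b1 {mapd} => /=; rewrite !power2_silent.
    rewrite /power2 /mac_power2 /=; apply: ler_wpM2r; first by rewrite invr_ge0 exprn_ge0// ltW.
    apply: ler_wpM2l => //; case: ifP => // _; case: b1 {mapd} => //=.
    by rewrite snr_gap0 lerD2l.
Qed.

Lemma mean_rate_drop1 b2 f : rate_map f -> rate_map (drop false b2 \o f) ->
  mean_rate (fst \o rates) (drop false b2 \o f) = mean_rate (fst \o rates) f.
Proof.
move=> mapf mapd; apply: EFin_inj.
have r0 i : 0 <= (fst \o rates) i by exact: nth_rate_ge0.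
by rewrite -(integral_rate _ _ mapf r0) -(integral_rate _ _ mapd r0).
Qed.

Lemma mean_rate_drop2 b1 f : rate_map f -> rate_map (drop b1 false \o f) ->
  mean_rate (snd \o rates) (drop b1 false \o f) = mean_rate (snd \o rates) f.
Proof.
move=> mapf mapd; apply: EFin_inj.
have r0 i : 0 <= (snd \o rates) i by exact: nth_rate_ge0.
by rewrite -(integral_rate _ _ mapf r0) -(integral_rate _ _ mapd r0).
Qed.

Lemma reachable_zero_power (lam : R * R) : reachable lam ->
  ((forall tau, 0 < tau -> exists f, [/\ rate_map f,
     (\int[P]_w (power1 (H w) (f (H w)))%:E <= tau%:E)%E &
     lam.1 - tau <= mean_rate (fst \o rates) f]) -> lam.1 = 0) /\
  ((forall tau, 0 < tau -> exists f, [/\ rate_map f,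
     (\int[P]_w (power2 (H w) (f (H w)))%:E <= tau%:E)%E &
     lam.2 - tau <= mean_rate (snd \o rates) f]) -> lam.2 = 0).
Proof.
move=> [l1 [l2 _]].
have gap_ge0 (j : 'I_(size Rs).+1) : 0 <= snr_gap (nth 0 (0 :: Rs) j).
  by apply: snr_gap_ge0; exact: nth_rate_ge0.
have cancel (h g c r : R) : 0 < h -> 0 <= g -> 1 <= c -> r <= g / ln 2 ->
    r <= h ^+ 2 * (g * c / h ^+ 2) / ln 2.
  move=> h0 g0 c1 rg; rewrite mulrCA divff ?mulr1 ?gt_eqF ?exprn_gt0//.
  apply: le_trans rg _; apply: ler_wpM2r; first by rewrite invr_ge0 ltW// ln2_gt0.
  by rewrite ler_peMr.
have c1 (b : bool) (g : R) : 0 <= g -> 1 <= (if b then 1 + g else 1).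
  by case: b => // ?; rewrite lerDl.
have c2 (b : bool) (g : R) : 0 <= g -> 1 <= (if b then 1 else 1 + g).
  by case: b => // ?; rewrite lerDl.
split=> small; apply/eqP; rewrite eq_le; apply/andP; split=> //.
- apply: (low_power_low_rate (fst \o rates) power1 fst) => //.
  + by move=> i /=; rewrite nth_rate_ge0 nth_rate_le.
  + by move=> n h [/andP[]].
  + by move=> h i h1 h2; apply: cancel => //; [exact: gap_ge0|exact: (c1 _ _ (gap_ge0 _))|exact: snr_gap_ge].
  + by move=> h f; exact: power1_map_ge0.
  + exact: measurable_power1.
- apply: (low_power_low_rate (snd \o rates) power2 snd) => //.
  + by move=> i /=; rewrite nth_rate_ge0 nth_rate_le.
  + by move=> n h [_ /andP[]].
  + by move=> h i h1 h2; apply: cancel => //; [exact: gap_ge0|exact: (c2 _ _ (gap_ge0 _))|exact: snr_gap_ge].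
  + by move=> h f; exact: power2_map_ge0.
  + exact: measurable_power2.
Qed.

Lemma reachable_MAC lam : reachable lam ->
  exists2 a, 0 <= a <= Pt & closure (supported P T H Rs MAC_transmittable
    (fun pi => forall t,
       (\int[P]_w ((pi t (traj T H w)).2.1)%:E <= a%:E)%E /\
       (\int[P]_w ((pi t (traj T H w)).2.2)%:E <= (Pt - a)%:E)%E)) lam.
Proof.
move=> reachlam; have [lam1 [lam2 reach]] := reachlam.
have delta_gt0 n : 0 < n.+1%:R^-1 :> R by rewrite invr_gt0.
have /choice[a Ha] : forall n, exists x, 0 <= x <= Pt /\
    forall theta, 0 <= theta <= 1 -> exists f, [/\
      feasible f ((1 + n.+1%:R^-1) * theta * x) ((1 + n.+1%:R^-1) * theta * (Pt - x)),
      theta * (lam.1 - n.+1%:R^-1) <= mean_rate (fst \o rates) f &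
      theta * (lam.2 - n.+1%:R^-1) <= mean_rate (snd \o rates) f].
  by move=> n; have [x x01 Hx] := reach _ (delta_gt0 n); exists x.
have [a0 [a0I cl]] : `[0, Pt]%classic `&` cluster (a @ \oo) !=set0.
  apply: (@segment_compact R 0 Pt); exists 0%N => // n _ /=.
  by rewrite in_itv /=; exact: (Ha n).1.
have a01 : 0 <= a0 <= Pt by move: a0I; rewrite /= in_itv.
have near_a0 tau : 0 < tau -> exists n, n.+1%:R^-1 < tau /\ `|a0 - a n| < tau.
  move=> tau0.
  have [x [[n /= Nn <-] xn]] := cl (a @` [set n | ((Num.truncn tau^-1).+1 <= n)%N])
    (ball a0 tau) (ex_intro2 _ _ (Num.truncn tau^-1).+1 I
      (fun n nN => ex_intro2 _ _ n nN erefl)) (nbhsx_ballx _ _ tau0).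
  exists n; split => //.
  rewrite invf_plt ?posrE//; apply: lt_trans (truncnS_gt _) _.
  by rewrite ltr_nat ltnS.
exists a0 => //.
have [z1 z2] := reachable_zero_power lam reachlam.
have [a00 a0P] := andP a01.
have zero1 : a0 = 0 -> lam.1 = 0.
  move=> a0E; apply: z1 => tau tau0.
  (* The bound 1 keeps the factor [1 + n.+1%:R^-1] below 2, so a split below [tau / 2] costs power
     at most [tau]. *)
  have [|n [dn an]] := near_a0 (Num.min (tau / 2) 1).
    by rewrite lt_min divr_gt0//=.
  have [an01 /(_ 1)[|f [[mapf f1 _] r1 _]]] := Ha n; first by rewrite ler01 lexx.
  move: dn an; rewrite !lt_min a0E sub0r normrN => /andP[d1 d2] /andP[]; have /andP[an0 _] := an01.
  rewrite ger0_norm// => an1 an2.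
  exists f; split => //.
    apply: le_trans f1 _; rewrite lee_fin mulr1.
    by move: d1 d2 (delta_gt0 n); move: (n.+1%:R^-1) (a n) an0 an1 => x y; nra.
  move: r1; rewrite mul1r; apply: le_trans; move: d1; move: (n.+1%:R^-1) => x; lra.
have zero2 : Pt - a0 = 0 -> lam.2 = 0.
  move=> a0E; apply: z2 => tau tau0.
  have [|n [dn an]] := near_a0 (Num.min (tau / 2) 1).
    by rewrite lt_min divr_gt0//=.
  have [an01 /(_ 1)[|f [[mapf _ f1] _ r1]]] := Ha n; first by rewrite ler01 lexx.
  move: dn an; have -> : a0 = Pt by lra.
  rewrite !lt_min => /andP[d1 d2] /andP[]; have /andP[_ anP] := an01.
  rewrite ger0_norm ?subr_ge0// => an1 an2.
  exists f; split => //.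
    apply: le_trans f1 _; rewrite lee_fin mulr1.
    have : 0 <= Pt - a n by lra.
    by move: d1 d2 (delta_gt0 n); move: (n.+1%:R^-1) (Pt - a n) an1 => x y; nra.
  move: r1; rewrite mul1r; apply: le_trans; move: d1; move: (n.+1%:R^-1) => x; lra.
apply: closure_shrink => // e e0.
(* Below 1, and small enough that thinning by [1 - eta] and a rate error below [e / 4] together cost
   less than [e]. *)
pose eta := e / (4 * (1 + lam.1 + lam.2) + e).
have den0 : 0 < 4 * (1 + lam.1 + lam.2) + e by lra.
have eta0 : 0 < eta by rewrite divr_gt0.
have etaE : eta * (4 * (1 + lam.1 + lam.2) + e) = e by rewrite divfK// gt_eqF.
have eta1 : eta < 1 by rewrite ltr_pdivrMr//; lra.
pose b0 := Pt - a0.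
have b00 : 0 <= b0 by rewrite /b0; lra.
(* How far the split may be from its limit for the thinned map to respect a positive budget [x]. For
   a zero budget any positive value does, as that user is silenced. *)
pose slack x := if x == 0 then 1 else eta * x / 2.
have slack0 x : 0 <= x -> 0 < slack x.
  rewrite /slack; case: eqP => // /eqP xn0 x0.
  by rewrite divr_gt0// mulr_gt0// lt_def xn0.
have slackE x : x != 0 -> slack x = eta * x / 2 by rewrite /slack => /negbTE ->.
have [|n [dn an]] := near_a0 (Num.min (Num.min (eta / 2) (e / 4)) (Num.min (slack a0) (slack b0))).
  by rewrite !lt_min !divr_gt0//= !slack0.
have [an01 /(_ (1 - eta))[|f [F r1 r2]]] := Ha n; first by apply/andP; split; lra.
move: dn an; rewrite !lt_min => /andP[/andP[d1 d2] _] /andP[_ /andP[an1 an2]].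
have dn0 := delta_gt0 n; move: dn0 d1 d2 F r1 r2; move: (n.+1%:R^-1) => x dn0 d1 d2 F r1 r2.
have /andP[an0 anP] := an01.
(* Since [x < eta / 2], the factor is at most 1 - eta/2, and its product with 1 + eta/2 is at most
   1. *)
have shrink y y0 : 0 < y0 -> y - y0 <= eta * y0 / 2 -> 0 <= y -> (1 + x) * (1 - eta) * y <= y0.
  move=> y00 yy yp.
  have c : (1 + x) * (1 - eta) <= 1 - eta / 2 by nra.
  by apply: le_trans (ler_wpM2r yp c) _; nra.
have F' : feasible (drop (a0 == 0) (b0 == 0) \o f) a0 b0.
  have [md g1 g2] := feasible_drop (a0 == 0) (b0 == 0) f _ _ F; split => //.
    apply: le_trans g1 _; rewrite lee_fin; case: eqP => // /eqP ane0.
    apply: shrink => //; first by rewrite lt_def ane0.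
    by move: an1; rewrite slackE// ltr_norml => /andP[]; lra.
  apply: le_trans g2 _; rewrite lee_fin; case: eqP => // /eqP bne0.
  apply: shrink => //; first by rewrite lt_def bne0.
    by move: an2; rewrite slackE// ltr_norml /b0 => /andP[]; lra.
  lra.
have mapf : rate_map f by case: F.
have mapd : rate_map (drop (a0 == 0) (b0 == 0) \o f) by case: F'.
have lt l m : 0 <= l -> l <= lam.1 + lam.2 -> (1 - eta) * (l - x) <= m -> l - e < m.
  by move=> l0 ll; apply: lt_le_trans; nra.
apply: (supported_MAC _ a0 b0 _ F') => /=.
- by rewrite le_max lexx orbT.
- by rewrite le_max lexx orbT.
- have [/zero1 ->|ane0] := eqVneq a0 0.
    by left; apply/max_idPr; lra.
  apply: max_lt_or; rewrite (negbTE ane0) in mapd *.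
  by rewrite mean_rate_drop1//; apply: lt r1; lra.
- have [/zero2 ->|bne0] := eqVneq b0 0.
    by left; apply/max_idPr; lra.
  apply: max_lt_or; rewrite (negbTE bne0) in mapd *.
  by rewrite mean_rate_drop2//; apply: lt r2; lra.
Qed.

End Regions.

Theorem theorem3 (R : realType) (d : measure_display) (Omega : measurableType d)
    (P : probability Omega R) (T : Omega -> Omega) (H : Omega -> R * R)
    (s1 s2 : R) (Rs : seq R) (Pt : R) :
  channel_model P T H s1 s2 ->
  (forall r, r \in Rs -> 0 < r) ->
  BC_stability_region P T H Rs Pt =
  \bigcup_(p in [set p : R * R | 0 <= p.1 /\ 0 <= p.2 /\ p.1 + p.2 = Pt])
     MAC_stability_region P T H Rs p.1 p.2.
Proof.
move=> chan Rs_gt0; apply/seteqP; split => lam.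
  move=> BClam; have : reachable P H Rs Pt lam.
    apply: (closure_supported_reachable P T H s1 s2 Rs Pt chan Rs_gt0) BClam.
    - by move=> h r p [? [? _]].
    - move=> h i p h1 h2; apply: BC_transmittable_power => //=; exact: nth_rate_ge0.
    - by [].
  move=> /(reachable_MAC P T H s1 s2 Rs Pt chan Rs_gt0)[a /andP[a0 aP] MAClam].
  by exists (a, Pt - a) => //=; split=> //; split; [rewrite subr_ge0|rewrite addrC subrK].
(* Conversely, only the sum of the two MAC budgets is retained, which is all that the BC
   constrains. *)
move=> [[p1 p2] /= [p10 [p20 pP]] MAClam].
apply: (reachable_BC P T H s1 s2 Rs Pt chan Rs_gt0).
apply: (closure_supported_reachable P T H s1 s2 Rs Pt chan Rs_gt0) MAClam.
- by move=> h r p [? [? _]].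
- move=> h i p h1 h2; apply: MAC_transmittable_power => //=; exact: nth_rate_ge0.
- move=> pi powP pow0 mpow t; have [mp1 mp2] := mpow t; have [q1 q2] := powP t.
  under eq_integral do rewrite EFinD.
  rewrite ge0_integralD//; last first.
  + exact/measurable_EFinP.
  + by move=> w _; rewrite lee_fin; have [] := pow0 t w.
  + exact/measurable_EFinP.
  + by move=> w _; rewrite lee_fin; have [] := pow0 t w.
  by rewrite -pP EFinD; exact: leeD.
Qed.
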